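(* Let $\mathcal{X}^\star\in\mathbb{R}^{d_1\times\cdots\times d_N}$ be a tensor with TT ranks $\mathbf{r}=(r_1,\dots,r_{N-1})$, and let $\{\boldsymbol{X}_i^\star\}_{i=1}^N$ be left-orthogonal form factors of a minimal TT decomposition of $\mathcal{X}^\star$. Consider the problem of minimizing $f(\boldsymbol{X}_1,\dots,\boldsymbol{X}_N)=\frac12\|[\boldsymbol{X}_1,\dots,\boldsymbol{X}_N]-\mathcal{X}^\star\|_F^2$ over factors $\boldsymbol{X}_i\in\mathbb{R}^{r_{i-1}\times d_i\times r_i}$ subject to $L(\boldsymbol{X}_i)^\top L(\boldsymbol{X}_i)=\mathbf{I}_{r_i}$ for $i=1,\dots,N-1$, and let $\{\boldsymbol{X}_i^{(t)}\}_{t\ge 0}$ be the iterates generated by the Riemannian gradient descent (RGD) algorithm (defined in the context) applied to $f$ with step size $\mu>0$, started from factors $\{\boldsymbol{X}_i^{(0)}\}$ with $L(\boldsymbol{X}_i^{(0)})^\top L(\boldsymbol{X}_i^{(0)})=\mathbf{I}_{r_i}$ for $i=1,\dots,N-1$. Suppose that the initialization satisfies $$\operatorname{dist}^2(\{\boldsymbol{X}_i^{(0)}\},\{\boldsymbol{X}_i^\star\})\le\frac{\underline{\sigma}^2(\mathcal{X}^\star)}{72(N^2-1)\left(N+1+\sum_{i=2}^{N-1}r_i\right)}$$ and that $\mu\le\frac{1}{9N-5}$. Then for all $t\ge 0$, $$\operatorname{dist}^2(\{\boldsymbol{X}_i^{(t+1)}\},\{\boldsymbol{X}_i^\star\})\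le\left(1-\frac{1}{64\left(N+1+\sum_{i=2}^{N-1}r_i\right)\kappa^2(\mathcal{X}^\star)}\,\mu\right)\operatorname{dist}^2(\{\boldsymbol{X}_i^{(t)}\},\{\boldsymbol{X}_i^\star\}).$$
   Context: Let $N\ge 2$. TT format: for factors $\boldsymbol{X}_i\in\mathbb{R}^{r_{i-1}\times d_i\times r_i}$, $i=1,\dots,N$, with $r_0=r_N=1$, write $\boldsymbol{X}_i(s_i)=\boldsymbol{X}_i(:,s_i,:)\in\mathbb{R}^{r_{i-1}\times r_i}$, and let $[\boldsymbol{X}_1,\dots,\boldsymbol{X}_N]\in\mathbb{R}^{d_1\times\cdots\times d_N}$ be the tensor with entries $\boldsymbol{X}_1(s_1)\boldsymbol{X}_2(s_2)\cdots\boldsymbol{X}_N(s_N)$. The left unfolding $L(\boldsymbol{X}_i)\in\mathbb{R}^{(r_{i-1}d_i)\times r_i}$ stacks $\boldsymbol{X}_i(1),\dots,\boldsymbol{X}_i(d_i)$ vertically; the right unfolding is $R(\boldsymbol{X}_i)=[\boldsymbol{X}_i(1)\ \cdots\ \boldsymbol{X}_i(d_i)]\in\mathbb{R}^{r_{i-1}\times(d_ir_i)}$. A decomposition $\mathcal{X}=[\boldsymbol{X}_1,\dots,\boldsymbol{X}_N]$ is minimal if $\operatorname{rank}L(\boldsymbol{X}_i)=r_i$ and $\operatorname{rank}R(\boldsymbol{X}_i)=r_{i-1}$ for all $i$; then $(r_1,\dots,r_{N-1})$ are the TT ranks of $\mathcal{X}$. Equivalently, $r_i$ is the rank of the $i$-th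 unfolding matrix $\mathcal{X}^{\langle i\rangle}\in\mathbb{R}^{(d_1\cdots d_i)\times(d_{i+1}\cdots d_N)}$, whose entry in the row indexed by $(s_1,\dots,s_i)$ and column indexed by $(s_{i+1},\dots,s_N)$ is $\mathcal{X}(s_1,\dots,s_N)$. Factors are in left-orthogonal form if $L(\boldsymbol{X}_i)^\top L(\boldsymbol{X}_i)=\mathbf{I}_{r_i}$ for $i=1,\dots,N-1$ (such minimal decompositions always exist). For a tensor $\mathcal{X}$ with TT ranks $(r_1,\dots,r_{N-1})$: $\underline{\sigma}(\mathcal{X})=\min_{1\le i\le N-1}\sigma_{r_i}(\mathcal{X}^{\langle i\rangle})$, $\overline{\sigma}(\mathcal{X})=\max_{1\le i\le N-1}\sigma_1(\mathcal{X}^{\langle i\rangle})$, $\kappa(\mathcal{X})=\overline{\sigma}(\mathcal{X})/\underline{\sigma}(\mathcal{X})$, where $\sigma_j$ denotes the $j$-th largest singular value. Distance: for orthogonal matrices $\boldsymbol{R}_i\in\mathbb{O}^{r_i\times r_i}$, $i=1,\dots,N-1$, with $\boldsymbol{R}_0=\boldsymbol{R}_N=1$, let $L_{\boldsymbol{R}}(\boldsymbol{X}_i^\star)$ be the vertical stack of $\boldsymbol{R}_{i-1}^\top\boldsymbol{X}_i^\star(s)\boldsymbol{R}_i$, $s=1,\dots,d_i$. Then $$\operatorname{dist}^2(\{\boldsymbol{X}_i\},\{\boldsymbol{X}_i^\star\})=\min_{\boldsymbol{R}_i\in\mathbb{O}^{r_i\times r_i},\,i\in[N-1]}\ \sum_{i=1}^{N-1}\overline{\sigma}^2(\mathcal{X}^\star)\|L(\boldsymbol{X}_i)-L_{\boldsymbol{R}}(\boldsymbol{X}_i^\star)\|_F^2+\|L(\boldsymbol{X}_N)-L_{\boldsymbol{R}}(\boldsymbol{X}_N^\star)\|_2^2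 .$$ RGD applied to an objective $F(\boldsymbol{X}_1,\dots,\boldsymbol{X}_N)$ with step size $\mu>0$: for each $t\ge 0$, with all gradients evaluated at $(\boldsymbol{X}_1^{(t)},\dots,\boldsymbol{X}_N^{(t)})$, $$L(\boldsymbol{X}_i^{(t+1)})=\operatorname{Retr}\Big(L(\boldsymbol{X}_i^{(t)})-\tfrac{\mu}{\overline{\sigma}^2(\mathcal{X}^\star)}\mathcal{P}_{L(\boldsymbol{X}_i^{(t)})}\big(\nabla_{L(\boldsymbol{X}_i)}F\big)\Big),\ i\in[N-1],\qquad L(\boldsymbol{X}_N^{(t+1)})=L(\boldsymbol{X}_N^{(t)})-\mu\nabla_{L(\boldsymbol{X}_N)}F,$$ where $\nabla_{L(\boldsymbol{X}_i)}F$ is the Euclidean gradient of $F$ with respect to $L(\boldsymbol{X}_i)$, $\mathcal{P}_{\boldsymbol{Y}}(\boldsymbol{B})=\boldsymbol{B}-\frac12\boldsymbol{Y}(\boldsymbol{B}^\top\boldsymbol{Y}+\boldsymbol{Y}^\top\boldsymbol{B})$ is the projection onto the tangent space of the Stiefel manifold at $\boldsymbol{Y}$, and $\operatorname{Retr}(\widehat{\boldsymbol{Y}})=\widehat{\boldsymbol{Y}}(\widehat{\boldsymbol{Y}}^\top\widehat{\boldsymbol{Y}})^{-1/2}$ is the polar retraction. *)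

(* Defs.v *)
From HB Require Import structures.
From mathcomp Require Import all_boot all_order all_algebra.
From mathcomp Require Import all_classical all_reals all_analysis.
From mathcomp Require Import polyrcf.
Set Implicit Arguments.
Unset Strict Implicit.
Unset Printing Implicit Defensive.
Import Order.TTheory GRing.Theory Num.Theory.
Import numFieldNormedType.Exports.
Local Open Scope classical_set_scope.
Local Open Scope ring_scope.

Section Matrices.
Variable R : realType.

Definition frob2 m n (A : 'M[R]_(m, n)) : R := \sum_i \sum_j A i j ^+ 2.

(* All the singular values of A, in nonincreasing order: the square roots of
   the eigenvalues of A^T A, each repeated according to its multiplicity in
   the characteristic polynomial ([rootsR] lists the distinct real roots). *)
Definition singular_values m n (A : 'M[R]_(m, n)) : seq R :=
  let p := char_poly (A^T *m A) in
  sort (fun x y => y <= x)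
    (flatten [seq nseq (mup x p) (Num.sqrt x) | x <- rootsR p]).

(* The j-th largest singular value, counting from j = 1. *)
Definition sing_val m n (A : 'M[R]_(m, n)) (j : nat) : R :=
  nth 0 (singular_values A) j.-1.

Definition sym_posdef n (S : 'M[R]_n) : Prop :=
  S^T = S /\ (forall v : 'rV[R]_n, v != 0 -> 0 < (v *m S *m v^T) 0 0).

(* A^(-1/2): the symmetric positive definite S with S^2 = A^-1; it exists and
   is unique when A is symmetric positive definite. *)
Definition invsqrtmx n (A : 'M[R]_n) : 'M[R]_n :=
  xget 0 [set S : 'M[R]_n | sym_posdef S /\ S *m S *m A = 1%:M].

Definition polar_retr m n (Y : 'M[R]_(m, n)) : 'M[R]_(m, n) :=
  Y *m invsqrtmx (Y^T *m Y).

Definition stiefel_proj m n (Y B : 'M[R]_(m, n)) : 'M[R]_(m, n) :=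
  B - 2^-1 *: (Y *m (B^T *m Y + Y^T *m B)).

Definition gradmx m n (g : 'M[R]_(m, n) -> R) (Y : 'M[R]_(m, n)) :
    'M[R]_(m, n) :=
  \matrix_(a, b) 'D_(delta_mx a b) (g : 'M[R]_(m, n) -> R^o) Y.

End Matrices.

Section TensorTrain.
Variables (R : realType) (N : nat).

(* Indexing: modes and factors are numbered from 0 to N - 1, so factor i has
   slices of size (rk i) x (rk (i + 1)), the first N - 1 factors are those with
   i + 1 < N, and the last one is that with i + 1 = N.  Ranks keep the usual
   numbering: [rk] takes the values r 1, ..., r (N - 1) of r and overrides the
   others so that the boundary ranks are 1. *)
Definition rk (r : nat -> nat) (k : nat) : nat :=
  if (0 < k < N)%N then r k else 1%N.

Lemma rk_last r : rk r N = 1%N.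
Proof. by rewrite /rk ltnn andbF. Qed.

Variables (d : 'I_N -> nat) (r : nat -> nat).

Definition mindex : finType := {dffun forall k : 'I_N, 'I_(d k)}.
Definition tensor : Type := mindex -> R.

Definition factors : Type :=
  forall i : 'I_N, 'I_(d i) -> 'M[R]_(rk r i, rk r i.+1).

Definition lunf (X : factors) (i : 'I_N) :
    'M[R]_(\sum_(s < d i) rk r i, rk r i.+1) :=
  \mxcol_(s < d i) X i s.

Definition runf (X : factors) (i : 'I_N) :
    'M[R]_(rk r i, \sum_(s < d i) rk r i.+1) :=
  \mxrow_(s < d i) X i s.

(* The product X_0(s_0) ... X_(n-1)(s_(n-1)) of the first n slices. *)
Fixpoint tt_prod (X : factors) (s : mindex) (n : nat) :
    (n <= N)%N -> 'M[R]_(rk r 0, rk r n) :=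
  match n with
  | 0 => fun _ => 1%:M
  | m.+1 => fun h : (m < N)%N =>
      tt_prod X s (ltnW h) *m X (Ordinal h) (s (Ordinal h))
  end.

(* The full product is a 1 x 1 matrix; this is its entry. *)
Definition tt (X : factors) : tensor := fun s =>
  tt_prod X s (leqnn N) (ord0 : 'I_1) (cast_ord (esym (rk_last r)) ord0).

Definition minimal_decomp (T : tensor) (X : factors) : Prop :=
  [/\ T = tt X,
      (forall i : 'I_N, \rank (lunf X i) = rk r i.+1) &
      (forall i : 'I_N, \rank (runf X i) = rk r i)].

Definition has_tt_ranks (T : tensor) : Prop := exists X, minimal_decomp T X.

Definition left_orth (X : factors) : Prop :=
  forall i : 'I_N, (i.+1 < N)%N -> (lunf X i)^T *m lunf X i = 1%:M.

(* i-th unfolding: rows are indexed by the first i modes, columns by the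
   others. *)
Definition row_index (i : nat) : finType :=
  {dffun forall k : {k : 'I_N | (k < i)%N}, 'I_(d (val k))}.
Definition col_index (i : nat) : finType :=
  {dffun forall k : {k : 'I_N | ~~ (k < i)%N}, 'I_(d (val k))}.

Definition merge_index (i : nat) (a : row_index i) (b : col_index i) : mindex :=
  [ffun k : 'I_N =>
     match boolP (k < i)%N with
     | AltTrue h => a (exist _ k h)
     | AltFalse h => b (exist _ k h)
     end].

Definition unfolding (T : tensor) (i : nat) :
    'M[R]_(#|row_index i|, #|col_index i|) :=
  \matrix_(a, b) T (merge_index (enum_val a) (enum_val b)).

(* The unit of each iterated operation is the value at i = 1, which is in
   the range since N >= 2. *)
Definition sigma_min (T : tensor) : R :=
  \big[Num.min/sing_val (unfolding T 1) (r 1)]_(1 <= i < N)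
    sing_val (unfolding T i) (r i).

Definition sigma_max (T : tensor) : R :=
  \big[Num.max/sing_val (unfolding T 1) 1]_(1 <= i < N)
    sing_val (unfolding T i) 1.

Definition cond_number (T : tensor) : R := sigma_max T / sigma_min T.

Definition rotations : Type := forall k : nat, 'M[R]_(rk r k).

Definition is_rotations (Q : rotations) : Prop :=
  [/\ (forall k, (Q k)^T *m Q k = 1%:M), Q 0%N = 1%:M & Q N = 1%:M].

Definition rotate (Q : rotations) (X : factors) : factors :=
  fun i s => (Q i)^T *m X i s *m Q i.+1.

(* [sb] is the weight sigma_max of the reference tensor.  The second sum has
   the last factor as its only term; its left unfolding is a column vector,
   whose Euclidean norm is its Frobenius norm. *)
Definition aligned_dist2 (sb : R) (X Xs : factors) (Q : rotations) : R :=
  \sum_(i < N | (i.+1 < N)%N)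
     sb ^+ 2 * frob2 (lunf X i - lunf (rotate Q Xs) i)
  + \sum_(i < N | i.+1 == N) frob2 (lunf X i - lunf (rotate Q Xs) i).

(* The infimum is a minimum: rotations range over a compact set. *)
Definition dist2 (sb : R) (X Xs : factors) : R :=
  inf [set aligned_dist2 sb X Xs Q | Q in is_rotations].

Definition tt_loss (T : tensor) (X : factors) : R :=
  2^-1 * \sum_(s : mindex) (tt X s - T s) ^+ 2.

Definition grad_lunf (F : factors -> R) (X : factors) (i : 'I_N) :
    'M[R]_(\sum_(s < d i) rk r i, rk r i.+1) :=
  gradmx
    (fun Y : 'M[R]_(\sum_(s < d i) rk r i, rk r i.+1) =>
       F (@dfwith _ _ X i (fun s : 'I_(d i) => submxcol Y s)))
    (lunf X i).

Definition rgd_iterates (F : factors -> R) (sb mu : R) (X : nat -> factors) :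
    Prop :=
  forall (t : nat) (i : 'I_N),
    lunf (X t.+1) i =
      if (i.+1 < N)%N then
        polar_retr (lunf (X t) i -
          (mu / sb ^+ 2) *: stiefel_proj (lunf (X t) i) (grad_lunf F (X t) i))
      else lunf (X t) i - mu *: grad_lunf F (X t) i.

End TensorTrain.

(* Main.v *)
(* Write D for the squared distance, y for the norm of the residual tt X - Xstar, and
   Delta_i = X_i - B_i where B is a rotated copy of the reference factors.

   Descent.  Replacing the factors B_i by X_i one at a time expresses the residual
   as a sum of tensors that are linear in Delta_i, so that the sum of the
   <grad_i, P(Delta_i)> is y^2 up to y times a term quadratic in the Delta_i.  The
   gradients are O(y), and the polar retraction of a tangent step does not increase
   the distance to a point of the Stiefel manifold.  Hence, with N mu bounded,
     D(t+1) <= D(t) - (3/2) mu y^2 + (2N + 3/2) mu y D(t) / sigma_max.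

   Lower bound.  The left parts U, V of X and Xs at level k are orthonormal bases of
   the column spaces of the k-th unfoldings, so the sine of the angle between these
   spaces is at most y / sigma_min; Procrustes rotations turn this into bounds on
   U - V Q_k and then, factor by factor, into
     sigma_min^2 D <= 4 (N + 1 + sum_i r_i) sigma_max^2 y^2.

   By the initial bound on D, the error term in the descent estimate is then at
   most mu y^2. *)

Require Import Defs.
From mathcomp Require Import all_boot all_order all_algebra.
From mathcomp Require Import all_classical all_reals all_analysis.
From mathcomp Require Import polyrcf complex.
From mathcomp Require Import ring lra.
Set Implicit Arguments.
Unset Strict Implicit.
Unset Printing Implicit Defensive.
Import Order.TTheory GRing.Theory Num.Theory.
Import numFieldNormedType.Exports.
Local Open Scope classical_set_scope.
Local Open Scope ring_scope.

(** * The Frobenius inner product *)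

Section Frobenius.
Variable R : realType.

(** Two kinds of rotation occur. The descent estimate runs with a rotation that is nearly optimal
    for the current distance; the lower bound builds its own rotations, one level at a time, and
    only uses that the distance is at most the aligned distance they produce. Both estimates need a
    small residual: y <= sigma_max / 2 keeps the right parts of X bounded, and y < sigma_min makes
    U^T V invertible in the Procrustes step. Both come from the bound on D, which is therefore
    carried through the iteration together with left orthogonality. Factors are exchanged with X on
    the left and B on the right. The left parts are then isometries, and a right part of B is a
    transposed isometry times an unfolding of Xstar, so its operator norm is at most sigma_max.
    Singular values are given as roots of a characteristic polynomial, whereas the proof needs them
    as bounds on matrix products; the spectral theorem for real symmetric matrices links the two. *)

Definition fdot m n (A B : 'M[R]_(m, n)) : R := \sum_i \sum_j A i j * B i j.

Definition fnorm m n (A : 'M[R]_(m, n)) : R := Num.sqrt (frob2 A).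

Lemma fdotE m n (A B : 'M[R]_(m, n)) : fdot A B = \tr (A^T *m B).
Proof.
rewrite /fdot /mxtrace exchange_big /=; apply: eq_bigr => j _.
by rewrite mxE; apply: eq_bigr => i _; rewrite mxE.
Qed.

Lemma frob2E m n (A : 'M[R]_(m, n)) : frob2 A = fdot A A.
Proof. by []. Qed.

Lemma fdotC m n (A B : 'M[R]_(m, n)) : fdot A B = fdot B A.
Proof. by apply: eq_bigr => i _; apply: eq_bigr => j _; rewrite mulrC. Qed.

Lemma fdotDr m n (A B C : 'M[R]_(m, n)) : fdot A (B + C) = fdot A B + fdot A C.
Proof. by rewrite !fdotE mulmxDr mxtraceD. Qed.

Lemma fdotDl m n (A B C : 'M[R]_(m, n)) : fdot (A + B) C = fdot A C + fdot B C.
Proof. by rewrite fdotC fdotDr !(fdotC C). Qed.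

Lemma fdotZr m n a (A B : 'M[R]_(m, n)) : fdot A (a *: B) = a * fdot A B.
Proof. by rewrite !fdotE -scalemxAr mxtraceZ. Qed.

Lemma fdotZl m n a (A B : 'M[R]_(m, n)) : fdot (a *: A) B = a * fdot A B.
Proof. by rewrite fdotC fdotZr fdotC. Qed.

Lemma fdotNr m n (A B : 'M[R]_(m, n)) : fdot A (- B) = - fdot A B.
Proof. by rewrite -scaleN1r fdotZr mulN1r. Qed.

Lemma fdotNl m n (A B : 'M[R]_(m, n)) : fdot (- A) B = - fdot A B.
Proof. by rewrite fdotC fdotNr fdotC. Qed.

Lemma fdotBr m n (A B C : 'M[R]_(m, n)) : fdot A (B - C) = fdot A B - fdot A C.
Proof. by rewrite fdotDr fdotNr. Qed.

Lemma fdotBl m n (A B C : 'M[R]_(m, n)) : fdot (A - B) C = fdot A C - fdot B C.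
Proof. by rewrite fdotDl fdotNl. Qed.

Lemma fdot0r m n (A : 'M[R]_(m, n)) : fdot A 0 = 0.
Proof. by rewrite fdotE mulmx0 mxtrace0. Qed.

Lemma fdot_tr m n (A B : 'M[R]_(m, n)) : fdot A^T B^T = fdot A B.
Proof. by rewrite !fdotE trmxK mxtrace_mulC -mxtrace_tr trmx_mul trmxK. Qed.

Lemma fdot_mull m n p (A : 'M[R]_(m, n)) (B : 'M[R]_(n, p)) (C : 'M[R]_(m, p)) :
  fdot (A *m B) C = fdot B (A^T *m C).
Proof. by rewrite !fdotE trmx_mul mulmxA. Qed.

Lemma fdot_mulr m n p (A : 'M[R]_(m, n)) (B : 'M[R]_(n, p)) (C : 'M[R]_(m, p)) :
  fdot (A *m B) C = fdot A (C *m B^T).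
Proof.
by rewrite -fdot_tr trmx_mul fdot_mull trmxK -fdot_tr trmxK trmx_mul !trmxK.
Qed.

Lemma frob2_ge0 m n (A : 'M[R]_(m, n)) : 0 <= frob2 A.
Proof. by apply: sumr_ge0 => i _; apply: sumr_ge0 => j _; rewrite sqr_ge0. Qed.

Lemma frob2_eq0 m n (A : 'M[R]_(m, n)) : (frob2 A == 0) = (A == 0).
Proof.
apply/eqP/eqP => [A0|->]; last first.
  by rewrite frob2E fdot0r.
apply/matrixP => i j; rewrite mxE; apply/eqP; rewrite -sqrf_eq0.
have/eqP := A0; rewrite psumr_eq0 => [|k _]; last first.
  by apply: sumr_ge0 => l _; rewrite sqr_ge0.
move/allP/(_ i (mem_index_enum _)) => /=.
rewrite psumr_eq0 => [|k _]; last by rewrite sqr_ge0.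
by move/allP/(_ j (mem_index_enum _)).
Qed.

Lemma frob2_tr m n (A : 'M[R]_(m, n)) : frob2 A^T = frob2 A.
Proof. by rewrite !frob2E fdot_tr. Qed.

Lemma frob2Z m n a (A : 'M[R]_(m, n)) : frob2 (a *: A) = a ^+ 2 * frob2 A.
Proof. by rewrite !frob2E fdotZl fdotZr mulrA expr2. Qed.

Lemma frob2N m n (A : 'M[R]_(m, n)) : frob2 (- A) = frob2 A.
Proof. by rewrite !frob2E fdotNl fdotNr opprK. Qed.

Lemma frob2D m n (A B : 'M[R]_(m, n)) :
  frob2 (A + B) = frob2 A + 2 * fdot A B + frob2 B.
Proof. by rewrite !frob2E fdotDl !fdotDr (fdotC B A); ring. Qed.

Lemma frob2B m n (A B : 'M[R]_(m, n)) :
  frob2 (A - B) = frob2 A - 2 * fdot A B + frob2 B.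
Proof. by rewrite frob2D fdotNr frob2N mulrN. Qed.

Lemma frob2D_le m n (A B : 'M[R]_(m, n)) :
  frob2 (A + B) <= 2 * frob2 A + 2 * frob2 B.
Proof. have := frob2_ge0 (A - B); rewrite frob2B frob2D; lra. Qed.

Lemma frob2B_le m n (A B : 'M[R]_(m, n)) :
  frob2 (A - B) <= 2 * frob2 A + 2 * frob2 B.
Proof. by rewrite -[frob2 B]frob2N frob2D_le. Qed.

Lemma fnorm_ge0 m n (A : 'M[R]_(m, n)) : 0 <= fnorm A.
Proof. exact: sqrtr_ge0. Qed.

Lemma sqr_fnorm m n (A : 'M[R]_(m, n)) : fnorm A ^+ 2 = frob2 A.
Proof. by rewrite sqr_sqrtr ?frob2_ge0. Qed.

Lemma sqr_fdot_le m n (A B : 'M[R]_(m, n)) :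
  fdot A B ^+ 2 <= frob2 A * frob2 B.
Proof.
have [/eqP|B0] := eqVneq (frob2 B) 0.
  by rewrite frob2_eq0 => /eqP ->; rewrite fdot0r (frob2E 0) fdot0r mulr0 expr0n.
have Bp : 0 < frob2 B by rewrite lt_def B0 frob2_ge0.
have := frob2_ge0 (frob2 B *: A - fdot A B *: B).
rewrite frob2B !frob2Z fdotZl fdotZr => h.
rewrite -(ler_pM2l Bp); move: h; set a := frob2 A; set b := frob2 B; set c := fdot A B.
lra.
Qed.

Lemma fdot_le m n (A B : 'M[R]_(m, n)) : fdot A B <= fnorm A * fnorm B.
Proof.
rewrite -sqrtrM ?frob2_ge0 //; apply: le_trans (ler_norm _) _.
by rewrite -sqrtr_sqr ler_wsqrtr // sqr_fdot_le.
Qed.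

Lemma fdot_ge m n (A B : 'M[R]_(m, n)) : - (fnorm A * fnorm B) <= fdot A B.
Proof. by rewrite lerNl -fdotNl; apply: le_trans (fdot_le _ _) _; rewrite /fnorm frob2N. Qed.

Lemma fnormD m n (A B : 'M[R]_(m, n)) : fnorm (A + B) <= fnorm A + fnorm B.
Proof.
rewrite -[leRHS]ger0_norm ?addr_ge0 ?fnorm_ge0 // -sqrtr_sqr ler_wsqrtr //.
rewrite frob2D sqrrD !sqr_fnorm; have := fdot_le A B; lra.
Qed.

Lemma fnorm0 m n : fnorm (0 : 'M[R]_(m, n)) = 0.
Proof. by rewrite /fnorm frob2E fdot0r sqrtr0. Qed.

Lemma fnorm_le m n (A : 'M[R]_(m, n)) c : 0 <= c ->
  (fnorm A <= c) = (frob2 A <= c ^+ 2).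
Proof. by move=> c0; rewrite -sqr_fnorm ler_pXn2r // nnegrE fnorm_ge0. Qed.

Lemma frob2_row m n (A : 'M[R]_(m, n)) : frob2 A = \sum_i frob2 (row i A).
Proof.
apply: eq_bigr => i _; rewrite /frob2 big_ord1.
by apply: eq_bigr => j _; rewrite mxE.
Qed.

Lemma frob2_rV n (v : 'rV[R]_n) : frob2 v = (v *m v^T) 0 0.
Proof.
rewrite /frob2 big_ord1 mxE; apply: eq_bigr => j _.
by rewrite mxE expr2.
Qed.

Lemma frob2_mulmx m n p (A : 'M[R]_(m, n)) (B : 'M[R]_(n, p)) :
  frob2 (A *m B) <= frob2 A * frob2 B.
Proof.
rewrite /frob2 mulr_suml; apply: ler_sum => i _.
rewrite [in leRHS]exchange_big /= mulr_sumr; apply: ler_sum => j _.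
have := sqr_fdot_le (row i A) (col j B)^T.
rewrite /fdot /frob2 !big_ord1 mxE.
congr (_ <= _); last by congr (_ * _); apply: eq_bigr => k _; rewrite !mxE.
by congr (_ ^+ 2); apply: eq_bigr => k _; rewrite !mxE.
Qed.

Lemma fnorm_mulmx m n p (A : 'M[R]_(m, n)) (B : 'M[R]_(n, p)) :
  fnorm (A *m B) <= fnorm A * fnorm B.
Proof. by rewrite -sqrtrM ?frob2_ge0 // ler_wsqrtr // frob2_mulmx. Qed.

Lemma frob2_isom m n p (U : 'M[R]_(m, n)) (A : 'M[R]_(n, p)) :
  U^T *m U = 1%:M -> frob2 (U *m A) = frob2 A.
Proof. by move=> hU; rewrite !frob2E fdot_mull mulmxA hU mul1mx. Qed.

Lemma frob2_isomr m n p (U : 'M[R]_(m, n)) (A : 'M[R]_(p, n)) :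
  U^T *m U = 1%:M -> frob2 (A *m U^T) = frob2 A.
Proof. by move=> hU; rewrite -frob2_tr trmx_mul trmxK frob2_isom // frob2_tr. Qed.

Lemma fnorm_isom m n p (U : 'M[R]_(m, n)) (A : 'M[R]_(n, p)) :
  U^T *m U = 1%:M -> fnorm (U *m A) = fnorm A.
Proof. by move=> hU; rewrite /fnorm frob2_isom. Qed.

Lemma fnorm_isomr m n p (U : 'M[R]_(m, n)) (A : 'M[R]_(p, n)) :
  U^T *m U = 1%:M -> fnorm (A *m U^T) = fnorm A.
Proof. by move=> hU; rewrite /fnorm frob2_isomr. Qed.

End Frobenius.

(** * Symmetric real matrices and singular values *)

Section Spectral.
Variable R : realType.

Lemma conjmx_real m n (A : 'M[R]_(m, n)) :
  map_mx (@conjc R) (map_mx (real_complex R) A) = map_mx (real_complex R) A.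
Proof. by apply/matrixP => i j; rewrite !mxE /= oppr0. Qed.

(** A complex eigenvector v exists, and v S v^* equals its own conjugate because S is real and
    symmetric. It is also a |v|^2 with |v|^2 real and nonzero, so a is real and is a root of the
    real characteristic polynomial. *)
Lemma sym_eigenvalue n (S : 'M[R]_n.+1) : S^T = S -> exists a, eigenvalue S a.
Proof.
move=> symS; pose Sc := map_mx (real_complex R) S.
have [a /eigenvalueP [v vS v0]] := eigenvalue_closed Sc (ltn0Sn n).
pose vh := map_mx (@conjc R) v^T.
have aux : (v *m Sc *m vh) 0 0 = a * (v *m vh) 0 0 by rewrite vS -scalemxAl mxE.
have vh_ge0 : (v *m vh) 0 0 != 0.
  rewrite mxE psumr_eq0 => [|i _]; last by rewrite !mxE mul_conjC_ge0.
  apply: contra v0 => /allP h; apply/eqP/rowP => i; rewrite mxE.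
  by have := h i (mem_index_enum _); rewrite !mxE mul_conjC_eq0 => /eqP.
have cvv : conjc ((v *m vh) 0 0) = (v *m vh) 0 0.
  rewrite !mxE rmorph_sum; apply: eq_bigr => i _.
  by rewrite rmorphM !mxE /= conjcK mulrC.
have cvSv : conjc ((v *m Sc *m vh) 0 0) = (v *m Sc *m vh) 0 0.
  have -> : conjc ((v *m Sc *m vh) 0 0) = (map_mx (@conjc R) (v *m Sc *m vh))^T 0 0.
    by rewrite !mxE.
  rewrite !map_mxM conjmx_real !trmx_mul -mulmxA.
  have -> : (map_mx (@conjc R) vh)^T = v.
    by apply/matrixP => i j; rewrite !mxE conjcK.
  have -> : (map_mx (@conjc R) v)^T = vh by rewrite /vh map_trmx.
  by rewrite /Sc map_trmx symS.
have ca : conjc a = a.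
  apply: (mulIf vh_ge0); rewrite -aux -cvSv aux rmorphM /=.
  by rewrite cvv.
have [x ax] : exists x, a = x%:C%C.
  exists (complex.Re a); move: ca; case: (a) => p q /= [qE].
  congr (_ +i* _)%C; lra.
have ra : root (char_poly Sc) a.
  by rewrite -eigenvalue_root_char; apply/eigenvalueP; exists v.
exists x; rewrite eigenvalue_root_char -(fmorph_root (real_complex R)).
by rewrite map_char_poly; move: ra; rewrite ax.
Qed.

Lemma orthmx_first_row n (v : 'rV[R]_n.+1) : frob2 v = 1 ->
  exists H : 'M[R]_n.+1, H^T *m H = 1%:M /\ row 0 H = v.
Proof.
move=> v1; pose e : 'rV[R]_n.+1 := delta_mx 0 0.
have eA m (A : 'M[R]_(_, m)) : e *m A = row 0 A by rewrite -rowE.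
have e1 : frob2 e = 1.
  rewrite frob2_rV eA !mxE.
  by rewrite !eqxx.
have [->|vNe] := eqVneq v e.
  by exists 1%:M; rewrite trmx1 mulmx1 row1.
pose u := e - v.
have u0 : frob2 u != 0 by rewrite frob2_eq0 subr_eq0 eq_sym.
have ue : 2 * fdot e u = frob2 u.
  by rewrite /u fdotBr -!frob2E frob2B e1 v1; ring.
(* Householder: the reflection exchanging e and v. *)
pose H : 'M[R]_n.+1 := 1%:M - (2 / frob2 u) *: (u^T *m u).
have uuT : u *m u^T = (frob2 u)%:M by rewrite frob2_rV -mx11_scalar.
have Hsym : H^T = H by rewrite /H linearB /= linearZ /= trmx1 trmx_mul trmxK.
exists H; split.
  have PP : (u^T *m u) *m (u^T *m u) = frob2 u *: (u^T *m u).
    by rewrite mulmxA -(mulmxA u^T) uuT -scalemx1 -scalemxAr mulmx1 -scalemxAl.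
  rewrite Hsym /H mulmxBr mulmx1 mulmxBl mul1mx -scalemxAl -scalemxAr PP.
  rewrite !scalerA -[in RHS](subr0 1%:M) -addrA; congr (_ + _).
  rewrite -scalerBl -opprD -scalerDl; congr (- _); rewrite -[RHS](scale0r (u^T *m u)).
  by congr (_ *: _); field.
rewrite -eA /H mulmxBr mulmx1 -scalemxAr mulmxA.
have -> : e *m u^T = (fdot e u)%:M.
  by rewrite fdotE -mxtrace_tr trmx_mul trmxK mxtrace_mulC [e *m _]mx11_scalar mxtrace_scalar.
rewrite mul_scalar_mx scalerA.
have -> : 2 / frob2 u * fdot e u = 1 by rewrite mulrAC ue divff.
by rewrite scale1r /u opprB addrC subrK.
Qed.

Lemma orth_block n (A : 'M[R]_n) : A^T *m A = 1%:M ->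
  (block_mx (1%:M : 'M[R]_1) 0 0 A)^T *m block_mx 1%:M 0 0 A = 1%:M.
Proof.
move=> hA; rewrite tr_block_mx mulmx_block !trmx0 !trmx1 !mulmx1 !mul1mx !mulmx0 !mul0mx.
by rewrite hA !addr0 !add0r -scalar_mx_block.
Qed.

(** Deflation: a unit eigenvector is completed to an orthogonal H having it as first row. In that
    basis the symmetry of S clears the first row and column off the diagonal, and the remaining
    block is handled by induction. *)
Lemma spectral_thm n (S : 'M[R]_n) : S^T = S ->
  exists O (e : 'rV[R]_n), O^T *m O = 1%:M /\ S = O^T *m diag_mx e *m O.
Proof.
elim: n S => [|n IH] S symS.
  by exists 1%:M, 0; split; apply/matrixP => -[].
have [a /eigenvalueP [w wS w0]] := sym_eigenvalue symS.
have nw : frob2 w != 0 by rewrite frob2_eq0.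
pose v := (Num.sqrt (frob2 w))^-1 *: w.
have v1 : frob2 v = 1 by rewrite frob2Z exprVn sqr_sqrtr ?frob2_ge0 // mulVf.
have vS : v *m S = a *: v by rewrite -scalemxAl wS !scalerA mulrC.
have [H [HH H0]] := orthmx_first_row v1.
have HHt : H *m H^T = 1%:M by apply: mulmx1C.
pose T : 'M[R]_(1 + n) := H *m S *m H^T.
have TdefE : T = H *m S *m H^T by [].
have symT : T^T = T by rewrite /T !trmx_mul trmxK symS mulmxA.
have T0 : row 0 T = a *: delta_mx 0 0.
  rewrite /T -mulmxA row_mul H0 mulmxA vS -scalemxAl -H0 -row_mul HHt.
  by rewrite row1.
have T0j j : T 0 j = a * (j == 0)%:R.
  by move/rowP/(_ j): T0; rewrite !mxE eqxx.
clearbody T.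
have l0 : lshift n (0 : 'I_1) = 0 by apply: val_inj.
have TE : T = block_mx a%:M 0 0 (drsubmx T).
  rewrite -[LHS]submxK; congr block_mx.
  - by apply/matrixP => i j; rewrite !mxE !ord1 l0 T0j mulr1.
  - by apply/matrixP => i j; rewrite !mxE !ord1 l0 T0j mulr0.
  - rewrite -symT -trmx_ursub -[RHS]trmx0; congr trmx.
    by apply/matrixP => i j; rewrite !mxE !ord1 l0 T0j mulr0.
have [|O [e [OO De]]] := IH (drsubmx T).
  by rewrite trmx_drsub symT.
pose K : 'M[R]_(1 + n) := block_mx 1%:M 0 0 O.
have KK : K^T *m K = 1%:M by apply: orth_block.
exists (K *m H), (row_mx a%:M e); split.
  by rewrite trmx_mul -mulmxA (mulmxA K^T) KK mul1mx.
rewrite trmx_mul -!mulmxA (mulmxA K^T) (mulmxA (K^T *m _)).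
have -> : K^T *m diag_mx (row_mx a%:M e) *m K = T.
  have -> : diag_mx (row_mx (a%:M : 'rV_1) e) = block_mx a%:M 0 0 (diag_mx e).
    by rewrite diag_mx_row; congr (block_mx _ _ _ _); apply/matrixP => i j; rewrite !mxE !ord1 eqxx.
  rewrite /K tr_block_mx !mulmx_block !trmx0 trmx1.
by rewrite !(mulmx0, mul0mx, mulmx1, mul1mx, addr0, add0r) -De -TE.
by rewrite TdefE -!mulmxA HH mulmx1 mulmxA HH mul1mx.
Qed.

End Spectral.

(** * Singular values as bounds on matrix products *)

Section SingularValues.
Variable R : realType.

Lemma char_poly_conj n (O A : 'M[R]_n) : O^T *m O = 1%:M ->
  char_poly (O^T *m A *m O) = char_poly A.
Proof.
move=> OO; rewrite /char_poly /char_poly_mx.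
have OOp : map_mx polyC O^T *m map_mx polyC O = 1%:M.
  by rewrite -map_mxM OO map_mx1.
have -> : 'X%:M - map_mx polyC (O^T *m A *m O) =
    map_mx polyC O^T *m ('X%:M - map_mx polyC A) *m map_mx polyC O.
  rewrite mulmxBr mulmxBl !map_mxM; congr (_ - _).
  by rewrite scalar_mxC -mulmxA OOp mulmx1.
by rewrite !det_mulmx mulrAC -det_mulmx OOp det1 mul1r.
Qed.

Lemma char_poly_diag n (e : 'rV[R]_n) :
  char_poly (diag_mx e) = \prod_(j < n) ('X - (e 0 j)%:P).
Proof.
rewrite char_poly_trig; last by rewrite diag_mx_is_trig.
by apply: eq_bigr => j _; rewrite !mxE eqxx.
Qed.

(** The upper bound writes the matrix as a sum of rank-one terms over the support of [e]. For the
    lower bound, adding the indicator [f] of the zeros of [e] gives an invertible matrix, and the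
    upper bound applied to [f] leaves at least the size of the support for [e]. *)
Lemma rank_diag n (e : 'rV[R]_n) :
  \rank (diag_mx e) = #|[pred j | e 0 j != 0]|.
Proof.
have le_supp (f : 'rV[R]_n) : (\rank (diag_mx f) <= #|[pred j | f 0%R j != 0%R]|)%N.
  have -> : diag_mx f = \sum_(j | f 0 j != 0) f 0 j *: delta_mx j j.
    apply/matrixP => i k; rewrite summxE !mxE.
    have [fi|fi] := eqVneq (f 0 i) 0.
      rewrite fi mul0rn big1 // => j fj; rewrite !mxE.
      by have [ij|_] := eqVneq i j; [rewrite -ij fi eqxx in fj|rewrite mulr0].
    rewrite (bigD1 i) //= !mxE eqxx /= big1 ?addr0; last first.
      by move=> j /andP[_ ji]; rewrite !mxE eq_sym (negPf ji) mulr0.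
    by rewrite [k == i]eq_sym mulr_natr.
  rewrite -sum1_card; elim/big_ind2: _ => [|A a B b hA hB|j _].
  - by rewrite mxrank0.
  - by apply: leq_trans (mxrank_add _ _) _; rewrite leq_add.
  - by apply: leq_trans (mxrankS (scalemx_sub _ (submx_refl _))) _; rewrite mxrank_delta.
apply/eqP; rewrite eqn_leq le_supp /=.
pose f : 'rV[R]_n := \row_j (e 0 j == 0)%:R.
have fE : #|[pred j | f 0 j != 0]| = (n - #|[pred j | e 0%R j != 0%R]|)%N.
  have := cardC [pred j | e 0 j != 0]; rewrite card_ord.
  have -> : #|[predC [pred j | e 0 j != 0]]| = #|[pred j | f 0 j != 0]|.
    by apply: eq_card => j; rewrite !inE !mxE negbK; case: eqP; rewrite ?eqxx ?oner_eq0.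
  by move: #|[pred j | f 0 j != 0]| #|[pred j | e 0 j != 0]| => a b <-; rewrite addKn.
have full : \rank (diag_mx e + diag_mx f)%R = n.
  have -> : diag_mx e + diag_mx f = diag_mx (e + f).
    by apply/matrixP => i j; rewrite !mxE -mulrnDl.
  apply: mxrank_unit; rewrite unitmxE det_diag unitfE prodf_seq_neq0.
  apply/allP => j _ /=; rewrite !mxE.
  by have [->|ej] := eqVneq (e 0 j) 0; rewrite ?add0r ?oner_eq0 ?addr0.
have := mxrank_add (diag_mx e) (diag_mx f).
rewrite full => h; have := le_supp f; rewrite fE => h2.
have h3 : (#|[pred j | e 0%R j != 0%R]| <= n)%N.
  by have := max_card [pred j | e 0 j != 0]; rewrite card_ord.
rewrite -(leq_add2r (n - #|[pred j | e 0%R j != 0%R]|)) subnKC //.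
by apply: leq_trans h _; rewrite leq_add2l.
Qed.

Lemma sorted_nth_ge (s : seq R) i j : sorted (fun x y => y <= x) s ->
  all (fun x => 0 <= x) s -> (i <= j)%N -> nth 0 s j <= nth 0 s i.
Proof.
move=> ss s0 ij; have [sj|js] := leqP (size s) j.
  rewrite (nth_default _ sj); have [si|si] := leqP (size s) i.
    by rewrite nth_default.
  by move/allP: s0; apply; rewrite mem_nth.
apply: (sorted_leq_nth _ _ 0 ss) => //; last by rewrite inE (leq_ltn_trans ij).
by move=> y x z /= h1 h2; apply: le_trans h2 h1.
Qed.

(** As the sequence decreases, its positive entries occupy exactly the positions 0 to [r.-1]. For
    singular values this identifies the r-th one, counted from 1, as the least nonzero one. *)
Lemma sorted_last_pos (s : seq R) r : sorted (fun x y => y <= x) s ->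
  all (fun x => 0 <= x) s -> (0 < r)%N -> count (fun x => 0 < x) s = r ->
  0 < nth 0 s r.-1 /\ (forall x, x \in s -> 0 < x -> nth 0 s r.-1 <= x).
Proof.
move=> ss s0 r0 cr.
have mono i j : (i <= j)%N -> nth 0 s j <= nth 0 s i by apply: sorted_nth_ge.
split.
  rewrite ltNge; apply/negP => h.
  have : (count (fun x : R => 0 < x)%R s <= r.-1)%N.
    rewrite -[s](cat_take_drop r.-1) count_cat.
    have -> : count (fun x => 0 < x) (drop r.-1 s) = 0%N.
      apply/eqP; rewrite -leqn0 leqNgt -has_count; apply/negP => /(has_nthP 0) [i _].
      by rewrite nth_drop ltNge (le_trans (mono _ _ (leq_addr i r.-1)) h).
    rewrite addn0; apply: leq_trans (count_size _ _) _.
    by rewrite size_take; case: ifP => // /negbT; rewrite -leqNgt.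
  by rewrite cr -ltnS prednK // ltnn.
move=> x xs x0; rewrite leNgt; apply/negP => h.
have ix : (r.-1 < index x s)%N.
  rewrite ltnNge; apply/negP => /mono; rewrite nth_index // => h2.
  by have := lt_le_trans h h2; rewrite ltxx.
rewrite prednK // in ix.
have : ((index x s).+1 <= count (fun x : R => 0 < x)%R s)%N.
  rewrite -[s in count _ s](cat_take_drop (index x s).+1) count_cat.
  apply: leq_trans (leq_addr _ _).
  have sz : size (take (index x s).+1 s) = (index x s).+1.
    by rewrite size_takel // index_mem.
  suff : all (fun x : R => 0 < x) (take (index x s).+1 s).
    by rewrite all_count sz => /eqP ->.
  apply/(all_nthP 0) => i; rewrite sz => isz.
  by rewrite nth_take // (lt_le_trans x0) // -[leLHS](nth_index 0 xs) mono.
by rewrite cr ltnNge ix.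
Qed.

Variables (m n : nat) (A : 'M[R]_(m, n)).

(** The characteristic polynomial is invariant under orthogonal conjugation, so it splits into the
    factors X - e_j, and the multiplicity of a root is its number of occurrences among the e_j. Each
    e_j is the squared norm of an eigenvector times A^T, hence nonnegative. *)
Lemma singular_values_spectral : exists Q (e : 'rV[R]_n),
  [/\ Q^T *m Q = 1%:M, A^T *m A = Q^T *m diag_mx e *m Q,
   (forall j, 0 <= e 0 j) &
   perm_eq (singular_values A) [seq Num.sqrt (e 0 j) | j <- enum 'I_n] ].
Proof.
have [|Q [e [QQ Ae]]] := @spectral_thm R n (A^T *m A).
  by rewrite trmx_mul trmxK.
have QQ' := mulmx1C QQ.
exists Q, e; split => //.
  move=> j; have -> : e 0 j = frob2 (row j Q *m A^T).
    have rQ : row j Q *m Q^T = delta_mx 0 j by rewrite -row_mul QQ' row1.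
    have rQ' : Q *m (row j Q)^T = (delta_mx 0 j)^T by rewrite -rQ trmx_mul trmxK.
    rewrite frob2_rV trmx_mul trmxK -!mulmxA (mulmxA A^T) Ae -!mulmxA rQ'.
    rewrite (mulmxA (row j Q)) rQ mulmxA -rowE trmx_delta -colE !mxE.
    by rewrite eqxx.
  exact: frob2_ge0.
rewrite /singular_values Ae char_poly_conj // char_poly_diag.
set s := [seq e 0 j | j <- enum 'I_n].
have -> : \prod_(j < n) ('X - (e 0 j)%:P) = \prod_(y <- s) ('X - y%:P).
  by rewrite /s big_map enumT.
set p := \prod_(y <- s) _.
have p0 : p != 0 by rewrite monic_neq0 // monic_prod_XsubC.
rewrite perm_sort; apply: perm_trans (_ : perm_eq _ [seq Num.sqrt y | y <- s]) _; last first.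
  by rewrite /s -map_comp.
have -> : flatten [seq nseq (mup x p) (Num.sqrt x) | x <- rootsR p] =
    [seq Num.sqrt y | y <- flatten [seq nseq (mup x p) x | x <- rootsR p]].
  rewrite map_flatten -map_comp; congr flatten; apply: eq_map => x /=.
  by rewrite map_nseq.
apply: perm_map; rewrite -(permPr (perm_count_undup s)).
under eq_map do rewrite mu_prod_XsubC.
apply/perm_flatten/perm_map/uniq_perm; rewrite ?undup_uniq //.
  exact: uniq_roots.
move=> x; rewrite mem_undup.
have := roots_onP (roots_on_rootsR p0) (x := x); rewrite in_itv /= => /(_ isT).
by rewrite root_prod_XsubC.
Qed.


Lemma singular_values_sorted : sorted (fun x y => y <= x) (singular_values A).
Proof. by apply: sort_sorted => x y; apply: le_total. Qed.

Lemma singular_values_ge0 : all (fun x => 0 <= x) (singular_values A).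
Proof.
have [Q [e [_ _ _ /perm_all ->]]] := singular_values_spectral.
by apply/allP => x /mapP [j _ ->]; rewrite sqrtr_ge0.
Qed.

Lemma sing_val_ge0 j : 0 <= sing_val A j.
Proof.
rewrite /sing_val; have [sj|js] := leqP (size (singular_values A)) j.-1.
  by rewrite nth_default.
by move/allP: singular_values_ge0; apply; rewrite mem_nth.
Qed.

Lemma sing_val_le1 j : sing_val A j <= sing_val A 1.
Proof. exact: sorted_nth_ge singular_values_sorted singular_values_ge0 _. Qed.

Lemma quad_diag n' (e y : 'rV[R]_n') :
  (y *m diag_mx e *m y^T) 0 0 = \sum_j e 0 j * y 0 j ^+ 2.
Proof.
rewrite mxE; apply: eq_bigr => j _.
by rewrite mul_mx_diag !mxE; ring.
Qed.

(** The spectral form of A^T A directly bounds w A^T, not d A. With w = d A one has <d, w A^T> =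
    |w|^2, and Cauchy-Schwarz carries the bound over to d A. *)
Lemma sing_val1_mulmx p (D : 'M[R]_(p, m)) :
  frob2 (D *m A) <= sing_val A 1 ^+ 2 * frob2 D.
Proof.
have [Q [e [QQ Ae e0 pe]]] := singular_values_spectral.
have QQ' := mulmx1C QQ.
have esig j : e 0 j <= sing_val A 1 ^+ 2.
  rewrite -[leLHS]sqr_sqrtr // ler_pXn2r ?nnegrE ?sqrtr_ge0 ?sing_val_ge0 //.
  have : Num.sqrt (e 0 j) \in singular_values A.
    by rewrite (perm_mem pe); apply/mapP; exists j; rewrite ?mem_enum.
  move=> /(nthP 0) [i isz <-].
  exact: sorted_nth_ge singular_values_sorted singular_values_ge0 _.
have up (w : 'rV[R]_n) : frob2 (w *m A^T) <= sing_val A 1 ^+ 2 * frob2 w.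
  have -> : frob2 w = frob2 (w *m Q^T) by rewrite frob2_isomr.
  rewrite frob2_rV trmx_mul trmxK !mulmxA -(mulmxA w) Ae !mulmxA.
  rewrite -mulmxA -{2}(trmxK Q) -trmx_mul quad_diag /frob2 big_ord1 mulr_sumr.
  by apply: ler_sum => j _; rewrite ler_wpM2r // sqr_ge0.
rewrite frob2_row (frob2_row D) mulr_sumr; apply: ler_sum => i _.
rewrite row_mul; set d := row i D; set w := d *m A.
have [/eqP|w0] := eqVneq (frob2 w) 0.
  by rewrite frob2_eq0 => /eqP ->; rewrite frob2E fdot0r mulr_ge0 ?sqr_ge0 ?frob2_ge0.
have wp : 0 < frob2 w by rewrite lt_def w0 frob2_ge0.
have h : fdot d (w *m A^T) = frob2 w by rewrite -fdot_mulr -frob2E.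
have := sqr_fdot_le d (w *m A^T); rewrite h => h2.
rewrite -(ler_pM2l wp) -expr2; apply: le_trans h2 _.
rewrite mulrCA mulrC; rewrite [leRHS]mulrA [leLHS]mulrC mulrC.
by rewrite ler_wpM2r ?frob2_ge0 ?up.
Qed.

(** U is an isometry, so A^T A = M^T M has rank r and the r-th singular value is the least nonzero
    one. Every row of D has the form z M^T since M has full row rank; in eigencoordinates of z the
    two sides are sums of e_j and of e_j^2, compared term by term, and the terms with e_j = 0
    vanish. *)
Lemma sing_val_rank r (U : 'M[R]_(m, r)) (M : 'M[R]_(r, n)) :
  (0 < r)%N -> U^T *m U = 1%:M -> A = U *m M -> row_free M ->
  0 < sing_val A r /\
  forall p (D : 'M[R]_(p, r)), sing_val A r ^+ 2 * frob2 D <= frob2 (D *m M).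
Proof.
move=> r0 UU AE fM.
have [Q [e [QQ Ae e0 pe]]] := singular_values_spectral.
have QQ' := mulmx1C QQ.
have AM : A^T *m A = M^T *m M.
  by rewrite AE trmx_mul -mulmxA (mulmxA U^T) UU mul1mx.
have Ou : Q \in unitmx by have [] := mulmx1_unit QQ.
have Otu : Q^T \in unitmx by rewrite unitmx_tr.
have cnt : count (fun x => 0 < x) (singular_values A) = r.
  rewrite (permP pe) count_map -(eqP fM) -mxrank_tr -(mxrankMfree M^T fM) -AM Ae.
  rewrite mxrankMfree ?row_free_unit // -mxrank_tr trmx_mul mxrankMfree ?row_free_unit ?trmxK //.
  rewrite tr_diag_mx rank_diag -sum1_count -sum1_card big_enum_cond.
  by apply: eq_bigl => j; rewrite !inE /= sqrtr_gt0 lt_def e0 andbT.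
have [sp smin] := sorted_last_pos singular_values_sorted singular_values_ge0 r0 cnt.
split => // p D.
have low (z : 'rV[R]_n) : sing_val A r ^+ 2 * frob2 (z *m M^T) <= frob2 (z *m M^T *m M).
  rewrite frob2_rV trmx_mul trmxK -mulmxA (mulmxA M^T) -AM.
  rewrite -(mulmxA z) -AM Ae.
  have -> : frob2 (z *m (Q^T *m diag_mx e *m Q)) = frob2 (z *m Q^T *m diag_mx e).
    have QQt : Q^T^T *m Q^T = 1%:M by rewrite trmxK.
    by rewrite -[in RHS](frob2_isomr _ QQt) trmxK !mulmxA.
  rewrite !mulmxA -mulmxA -{2}(trmxK Q) -trmx_mul quad_diag /frob2 big_ord1 mulr_sumr.
  apply: ler_sum => j _; rewrite mul_mx_diag [in leRHS]mxE exprMn mulrA [leRHS]mulrC.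
  rewrite ler_wpM2r ?sqr_ge0 //.
  have [-> |ej] := eqVneq (e 0 j) 0; first by rewrite mulr0 expr0n.
  have ejp : 0 < e 0 j by rewrite lt_def ej e0.
  rewrite [in leRHS]expr2 ler_pM2r // -[leRHS]sqr_sqrtr // ler_pXn2r ?nnegrE ?sqrtr_ge0 ?sing_val_ge0 //.
  apply: smin; last by rewrite sqrtr_gt0.
  by rewrite (perm_mem pe); apply/mapP; exists j; rewrite ?mem_enum.
rewrite frob2_row (frob2_row (D *m M)) mulr_sumr; apply: ler_sum => i _.
rewrite row_mul.
have /submxP [z ->] : (row i D <= M^T)%MS.
  by rewrite submx_full // /row_full mxrank_tr.
exact: low.
Qed.

End SingularValues.

(** * Polar factors and the Stiefel manifold *)

Section Polar.
Variable R : realType.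

Lemma trmxB m n (A B : 'M[R]_(m, n)) : (A - B)^T = A^T - B^T.
Proof. exact: linearB. Qed.

Lemma frob2_gt0 n (v : 'rV[R]_n) : v != 0 -> 0 < frob2 v.
Proof. by move=> v0; rewrite lt_def frob2_eq0 v0 frob2_ge0. Qed.

Lemma orth_rV_neq0 n (Q : 'M[R]_n) (v : 'rV[R]_n) :
  Q^T *m Q = 1%:M -> v != 0 -> v *m Q^T != 0.
Proof.
by move=> QQ v0; rewrite -frob2_eq0 frob2_isomr // frob2_eq0.
Qed.

Lemma quad_conj n (Q : 'M[R]_n) (e v : 'rV[R]_n) :
  (v *m (Q^T *m diag_mx e *m Q) *m v^T) 0 0 =
  \sum_j e 0 j * (v *m Q^T) 0 j ^+ 2.
Proof. by rewrite -quad_diag trmx_mul trmxK !mulmxA. Qed.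

Lemma frob2_delta n (j : 'I_n) : frob2 (delta_mx 0 j : 'rV[R]_n) = 1.
Proof. by rewrite frob2_rV trmx_delta -rowE !mxE !eqxx. Qed.

Lemma frob2_row_orth n (Q : 'M[R]_n) j : Q *m Q^T = 1%:M -> frob2 (row j Q) = 1.
Proof.
move=> QQ; have QQt : Q^T^T *m Q^T = 1%:M by rewrite trmxK.
by rewrite rowE -[Q]trmxK frob2_isomr // frob2_delta.
Qed.

Lemma diag_mx_gt0 n (Q : 'M[R]_n) (e : 'rV[R]_n) : Q^T *m Q = 1%:M ->
  sym_posdef (Q^T *m diag_mx e *m Q) <-> (forall j, 0 < e 0 j).
Proof.
move=> QQ; split=> [[_ pd] j|e0].
  have QQ' := mulmx1C QQ.
  have := pd (row j Q); rewrite quad_conj -row_mul QQ' row1.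
  rewrite (bigD1 j) //= !mxE !eqxx expr1n mulr1 big1 ?addr0.
    by apply; rewrite -frob2_eq0 frob2_row_orth ?oner_eq0.
  by move=> i ij; rewrite !mxE (negPf ij) expr0n mulr0.
split=> [|v v0].
  by rewrite !trmx_mul trmxK tr_diag_mx mulmxA.
rewrite quad_conj; have := orth_rV_neq0 QQ v0.
move: (v *m Q^T) => y y0.
rewrite lt_def sumr_ge0 ?andbT; last first.
  by move=> j _; rewrite mulr_ge0 ?sqr_ge0 // ltW.
apply: contra y0; rewrite psumr_eq0; last first.
  by move=> j _; rewrite mulr_ge0 ?sqr_ge0 // ltW.
move=> /allP h; apply/eqP/rowP => j; rewrite mxE; apply/eqP.
have /= := h j (mem_index_enum _).
by rewrite mulf_eq0 sqrf_eq0 gt_eqF.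
Qed.

(** The default value of [xget] is ruled out by a witness: the inverse square roots of the
    eigenvalues in an eigenbasis of A. *)
Lemma invsqrtmxP n (A : 'M[R]_n) : sym_posdef A ->
  sym_posdef (invsqrtmx A) /\ invsqrtmx A *m invsqrtmx A *m A = 1%:M.
Proof.
move=> pdA; rewrite /invsqrtmx; case: xgetP => [_ _ [] //|].
have [Q [e [QQ Ae]]] := spectral_thm pdA.1.
have e0 : forall j, 0 < e 0 j by apply/(diag_mx_gt0 e QQ); rewrite -Ae.
pose f : 'rV[R]_n := \row_j (Num.sqrt (e 0 j))^-1.
move/(_ (Q^T *m diag_mx f *m Q)); case; split.
  by apply/diag_mx_gt0 => // j; rewrite mxE invr_gt0 sqrtr_gt0.
have QQ' := mulmx1C QQ.
rewrite Ae -!mulmxA !(mulmxA Q) QQ' !mul1mx (mulmxA (diag_mx f)) (mulmxA _ (diag_mx e)).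
rewrite mulmx_diag mulmx_diag.
rewrite (_ : (\row_j _) = const_mx 1) ?diag_const_mx ?mul1mx //.
apply/rowP => j; rewrite !mxE -invfM -expr2 sqr_sqrtr ?ltW // mulVf // gt_eqF //.
Qed.

(** Testing the expansion hypothesis on the eigenvectors [row j Q] shows that every eigenvalue of P,
    already positive, is at least 1. *)
Lemma posdef_ge1 n (P : 'M[R]_n) : sym_posdef P ->
  (forall v : 'rV[R]_n, frob2 v <= frob2 (v *m P)) ->
  forall v : 'rV[R]_n, frob2 v <= (v *m P *m v^T) 0 0.
Proof.
move=> pdP hP; have [Q [e [QQ Pe]]] := spectral_thm pdP.1.
have QQ' := mulmx1C QQ.
have e0 : forall j, 0 < e 0 j by apply/(diag_mx_gt0 e QQ); rewrite -Pe.
have PP (v : 'rV[R]_n) : frob2 (v *m P) = \sum_j e 0 j ^+ 2 * (v *m Q^T) 0 j ^+ 2.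
  have -> : frob2 (v *m P) = frob2 (v *m Q^T *m diag_mx e).
    rewrite Pe; have QQt : Q^T^T *m Q^T = 1%:M by rewrite trmxK.
    by rewrite -[in RHS](frob2_isomr _ QQt) trmxK !mulmxA.
  rewrite /frob2 big_ord1; apply: eq_bigr => j _.
  by rewrite mul_mx_diag mxE exprMn mulrC.
have e1 j : 1 <= e 0 j.
  have := hP (row j Q); rewrite PP -row_mul QQ' row1.
  rewrite (bigD1 j) //= !mxE !eqxx expr1n mulr1 big1 ?addr0; last first.
    by move=> i ij; rewrite !mxE (negPf ij) expr0n mulr0.
  rewrite frob2_row_orth //.
  by rewrite expr_ge1 // ltW.
move=> v; rewrite -(frob2_isomr v QQ) Pe quad_conj /frob2 big_ord1.
by apply: ler_sum => j _; rewrite ler_peMl ?sqr_ge0.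
Qed.

Lemma fdot_row m n (A B : 'M[R]_(m, n)) :
  fdot A B = \sum_i (row i A *m (row i B)^T) 0 0.
Proof.
apply: eq_bigr => i _; rewrite mxE; apply: eq_bigr => j _.
by rewrite !mxE.
Qed.

Lemma quad_ge0_fdot m n (K : 'M[R]_n) (Z : 'M[R]_(m, n)) :
  (forall v : 'rV[R]_n, 0 <= (v *m K *m v^T) 0 0) -> 0 <= fdot (Z *m K) Z.
Proof. by move=> K0; rewrite fdot_row sumr_ge0 // => i _; rewrite row_mul. Qed.

Lemma quad_ge1_fdot m n (P : 'M[R]_n) (Z : 'M[R]_(m, n)) :
  (forall v : 'rV[R]_n, frob2 v <= (v *m P *m v^T) 0 0) ->
  0 <= fdot (Z *m (P - 1%:M)) Z.
Proof.
move=> P1; apply: quad_ge0_fdot => v.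
by rewrite mulmxBr mulmx1 mulmxBl [leRHS]mxE [X in _ + X]mxE -frob2_rV subr_ge0.
Qed.

(** H is the positive square root of A, the symmetric factor of the polar decomposition. *)
Lemma invsqrt_facts n (A : 'M[R]_n) : sym_posdef A ->
  exists H, [/\ invsqrtmx A *m H = 1%:M, H *m invsqrtmx A = 1%:M, H *m H = A & sym_posdef H].
Proof.
move=> pdA; have := invsqrtmxP pdA; move: (invsqrtmx A) => S [[St Spos] SSA].
exists (S *m A); set H := S *m A.
have SH : S *m H = 1%:M by rewrite /H mulmxA.
have HS := mulmx1C SH.
have HH : H *m H = A by rewrite {2}/H mulmxA HS mul1mx.
clearbody H.
have Ht : H^T = H.
  have HtS : H^T *m S = 1%:M by rewrite -{1}St -trmx_mul SH trmx1.
  by rewrite -[H^T]mulmx1 -SH mulmxA HtS mul1mx.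
split => //; split => // v v0.
have -> : v *m H *m v^T = (v *m H) *m S *m (v *m H)^T.
  by rewrite trmx_mul Ht -!mulmxA (mulmxA S) SH mul1mx.
apply: Spos; apply: contra v0 => /eqP vH.
by rewrite -[v]mulmx1 -HS mulmxA vH mul0mx.
Qed.

Lemma polar_retr_nonexp m n (Y B : 'M[R]_(m, n)) :
  B^T *m B = 1%:M ->
  (forall v : 'rV[R]_n, frob2 v <= frob2 (v *m Y^T)) ->
  (polar_retr Y)^T *m polar_retr Y = 1%:M /\
  frob2 (polar_retr Y - B) <= frob2 (Y - B).
Proof.
move=> BB Y1.
have quadA (v : 'rV[R]_n) : (v *m (Y^T *m Y) *m v^T) 0 0 = frob2 (v *m Y^T).
  by rewrite frob2_rV trmx_mul trmxK !mulmxA.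
have pdA : sym_posdef (Y^T *m Y).
  split=> [|v v0]; first by rewrite trmx_mul trmxK.
  by rewrite quadA; apply: lt_le_trans (Y1 v); apply: frob2_gt0.
rewrite /polar_retr; have [H] := invsqrt_facts pdA; have [] := invsqrtmxP pdA.
move: (invsqrtmx _) => S pdS _ [SH HS HH pdH].
set W := Y *m S.
have WW : W^T *m W = 1%:M.
  by rewrite /W trmx_mul pdS.1 -!mulmxA (mulmxA Y^T) -HH !mulmxA SH mul1mx.
split=> //.
have YE : Y = W *m H by rewrite /W -mulmxA SH mulmx1.
clearbody W.
have H1 (v : 'rV[R]_n) : frob2 v <= (v *m H *m v^T) 0 0.
  apply: posdef_ge1 => // u; apply: le_trans (Y1 u) _.
  by rewrite -quadA -HH [leRHS]frob2_rV trmx_mul pdH.1 !mulmxA.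
set Z := W - B; set K := H - 1%:M.
have Kt : K^T = K by rewrite /K linearB /= trmx1 pdH.1.
have -> : Y - B = W *m K + Z.
  by rewrite YE /K /Z mulmxBr mulmx1 addrA subrK.
(* |W H - B|^2 = |H - 1|^2 + tr ((H - 1) (W - B)^T (W - B)) + |W - B|^2 and H >= 1 *)
rewrite [leRHS]frob2D frob2_isom //.
(* W and B both have orthonormal columns, so Z^T Z is the sum of W^T Z and its transpose; K is
   symmetric and does not see the difference between the two. *)
have -> : 2 * fdot (W *m K) Z = fdot (Z *m K) Z.
  have WZ : W^T *m Z = 1%:M - W^T *m B by rewrite mulmxBr WW.
  have ZZ : Z^T *m Z = W^T *m Z + (W^T *m Z)^T.
    have Zt : Z^T = W^T - B^T by apply: trmxB.
    have BZ : B^T *m Z = B^T *m W - 1%:M by rewrite mulmxBr BB.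
    by rewrite trmx_mul trmxK {2}Zt mulmxBl WW {1}Zt mulmxBl BZ opprB.
  rewrite !fdot_mull ZZ fdotDr -{3}Kt fdot_tr; ring.
have := quad_ge1_fdot Z H1; rewrite -/K; have := frob2_ge0 K; lra.
Qed.

(* With C = U^T V invertible, Q is the transpose of the orthogonal factor of the
   polar decomposition of C. *)
Lemma procrustes m n (U V : 'M[R]_(m, n)) :
  U^T *m U = 1%:M -> V^T *m V = 1%:M ->
  frob2 (V - U *m (U^T *m V)) < 1 ->
  exists Q : 'M[R]_n, Q^T *m Q = 1%:M /\
    frob2 (U - V *m Q) <= 2 * frob2 (V - U *m (U^T *m V)).
Proof.
move=> UU VV; set C := U^T *m V; set E := V - U *m C => E1.
have UE : U^T *m E = 0 by rewrite /E mulmxBr mulmxA UU mul1mx subrr.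
have VE : V = U *m C + E by rewrite addrC subrK.
have EU : E^T *m U = 0 by apply: trmx_inj; rewrite trmx_mul trmxK UE trmx0.
(* The columns of U C and of E are orthogonal and add up to the isometry V, which gives a
   Pythagorean splitting of any D. *)
have pyth p (D : 'M[R]_(p, n)) : frob2 D = frob2 (D *m C^T) + frob2 (D *m E^T).
  rewrite -(frob2_isomr D VV) {1}VE linearD /= mulmxDr frob2D.
  rewrite trmx_mul mulmxA (frob2_isomr _ UU) fdot_mulr trmxK -mulmxA.
  by rewrite EU mulmx0 fdot0r mulr0 addr0.
clearbody C.
have quadA (v : 'rV[R]_n) : (v *m (C^T *m C) *m v^T) 0 0 = frob2 (v *m C^T).
  by rewrite frob2_rV trmx_mul trmxK !mulmxA.
have pdA : sym_posdef (C^T *m C).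
  split=> [|v v0]; first by rewrite trmx_mul trmxK.
  rewrite quadA; have := pyth _ v; have := frob2_mulmx v E^T.
  rewrite frob2_tr; have := frob2_gt0 v0; nra.
have [H] := invsqrt_facts pdA; have [] := invsqrtmxP pdA.
move: (invsqrtmx _) => S pdS _ [SH HS HH pdH].
set W := C *m S.
have WW : W^T *m W = 1%:M.
  by rewrite /W trmx_mul pdS.1 -!mulmxA (mulmxA C^T) -HH !mulmxA SH mul1mx.
have WW' := mulmx1C WW.
have S1 (v : 'rV[R]_n) : frob2 v <= (v *m S *m v^T) 0 0.
  apply: posdef_ge1 => // u.
  have -> : frob2 u = frob2 (u *m S *m C^T).
    by rewrite -quadA -HH trmx_mul pdS.1 !mulmxA -(mulmxA u) SH mulmx1 -(mulmxA u) HS mulmx1 frob2_rV.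
  by rewrite [leRHS]pyth lerDl frob2_ge0.
have WWt : W^T^T *m W^T = 1%:M by rewrite trmxK.
exists W^T; split=> //.
have -> : frob2 (U - V *m W^T) = frob2 (U *m (W - C) - E).
  rewrite -(frob2_isomr _ WWt) trmxK mulmxBl -mulmxA WW mulmx1.
  by rewrite /E mulmxBr opprB addrA subrK.
rewrite frob2B frob2_isom // fdot_mull UE fdot0r mulr0 subr0.
have CE : C = W *m H by rewrite /W -mulmxA SH mulmx1.
have -> : frob2 (W - C) = frob2 (1%:M - H).
  by rewrite [X in W - X]CE -{1}[W]mulmx1 -mulmxBr frob2_isom.
(* With [pyth] at the identity, |1|^2 = |H|^2 + |E|^2; and S >= 1 gives <1, H> >= |H|^2. Together |1
   - H|^2 <= |E|^2, and the other |E|^2 of the bound is the orthogonal part of the difference. *)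
have := pyth _ (1%:M : 'M[R]_n); rewrite !mul1mx !frob2_tr {1}CE frob2_isom // => h.
have := quad_ge1_fdot H S1; rewrite mulmxBr HS mulmx1 fdotBl -frob2E.
rewrite frob2B; move: h; lra.
Qed.

(** * The tangent projection of the Stiefel manifold *)

Section StiefelProj.
Variables (m n : nat) (Y : 'M[R]_(m, n)).
Hypothesis YY : Y^T *m Y = 1%:M.

Lemma fdot_sym_part k (A B : 'M[R]_k) : B^T = B -> fdot (A^T + A) B = 2 * fdot A B.
Proof. by move=> Bt; rewrite fdotDl -[in fdot A^T _]Bt fdot_tr; ring. Qed.

Lemma stiefel_proj_selfadj (B C : 'M[R]_(m, n)) :
  fdot (stiefel_proj Y B) C = fdot B (stiefel_proj Y C).
Proof.
rewrite /stiefel_proj fdotBl fdotBr fdotZl fdotZr; congr (_ - _ * _).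
rewrite fdot_mull [RHS]fdotC fdot_mull.
have st (A : 'M[R]_(m, n)) : (A^T *m Y + Y^T *m A)^T = A^T *m Y + Y^T *m A.
  by rewrite linearD /= !trmx_mul !trmxK addrC.
have half (A D : 'M[R]_(m, n)) :
    2 * fdot (A^T *m Y + Y^T *m A) (Y^T *m D) = fdot (A^T *m Y + Y^T *m A) (D^T *m Y + Y^T *m D).
  by rewrite fdotC -fdot_sym_part // trmx_mul trmxK fdotC.
have := half B C; have := half C B.
rewrite [X in _ = X -> _ -> _]fdotC => <-; lra.
Qed.

Lemma stiefel_proj_tangent (B : 'M[R]_(m, n)) :
  Y^T *m stiefel_proj Y B + (stiefel_proj Y B)^T *m Y = 0.
Proof.
rewrite /stiefel_proj; set T := B^T *m Y + Y^T *m B.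
have Tt : T^T = T by rewrite /T linearD /= !trmx_mul !trmxK addrC.
have -> : (B - 2^-1 *: (Y *m T))^T = B^T - 2^-1 *: (T *m Y^T).
  by rewrite linearB /= linearZ /= trmx_mul Tt.
rewrite mulmxBr -scalemxAr mulmxA YY mul1mx.
rewrite mulmxBl -scalemxAl -mulmxA YY mulmx1.
rewrite addrACA -opprD -scalerDl [_ + _ in X in X - _]addrC -/T.
by rewrite (_ : 2^-1 + 2^-1 = 1) ?scale1r ?subrr //; field.
Qed.

(** The part of B removed by the projection is Y times a symmetric matrix, which is orthogonal to
    tangent vectors because these have a skew Y^T P. *)
Lemma frob2_stiefel_proj (B : 'M[R]_(m, n)) :
  frob2 (stiefel_proj Y B) = fdot B (stiefel_proj Y B).
Proof.
set P := stiefel_proj Y B.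
have -> : B = P + 2^-1 *: (Y *m (B^T *m Y + Y^T *m B)) by rewrite subrK.
rewrite fdotDl fdotZl [fdot (_ *m _) _]fdot_mull -frob2E.
set T := B^T *m Y + _; have Tt : T^T = T by rewrite /T linearD /= !trmx_mul !trmxK addrC.
rewrite [fdot T _]fdotC; have := fdot_sym_part (Y^T *m P) Tt.
rewrite trmx_mul trmxK addrC stiefel_proj_tangent fdotC fdot0r; lra.
Qed.

Lemma stiefel_proj_diff (B : 'M[R]_(m, n)) : B^T *m B = 1%:M ->
  stiefel_proj Y (Y - B) = (Y - B) - 2^-1 *: (Y *m ((Y - B)^T *m (Y - B))).
Proof.
move=> BB; rewrite /stiefel_proj; congr (_ - _ *: (_ *m _)).
rewrite linearB /= !mulmxBl !mulmxBr YY BB.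
by rewrite opprB addrACA [- _ - _]addrC addrACA.
Qed.

(** Y^T P is skew for a tangent P, so the cross term vanishes and the squared norm only gains c^2 |v
    P^T|^2. This is the expansion hypothesis of [polar_retr_nonexp]: a tangent step leaves the
    manifold outwards. *)
Lemma stiefel_step_expand (B : 'M[R]_(m, n)) c (v : 'rV[R]_n) :
  frob2 v <= frob2 (v *m (Y - c *: stiefel_proj Y B)^T).
Proof.
set P := stiefel_proj Y B.
rewrite linearB /= linearZ /= mulmxBr frob2B frob2_isomr // -scalemxAr.
have -> : fdot (v *m Y^T) (c *: (v *m P^T)) = 0.
  rewrite fdotZr.
  suff : 2 * fdot (v *m Y^T) (v *m P^T) = 0 by move=> h; rewrite (_ : fdot _ _ = 0) ?mulr0 //; lra.
  rewrite mulr_natl mulr2n {1}fdot_mulr [X in _ + X]fdotC [X in _ + X]fdot_mulr !trmxK -fdotDr.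
  by rewrite -!mulmxA -mulmxDr addrC stiefel_proj_tangent mulmx0 fdot0r.
by rewrite mulr0 subr0 lerDl frob2_ge0.
Qed.

End StiefelProj.

End Polar.

(** * Tensor trains and their unfoldings *)

Section TTStructure.
Variables (R : realType) (N : nat) (d : 'I_N -> nat) (r : nat -> nat).
Implicit Types (X B : factors R d r) (s : mindex d).

Lemma ord_eq1 n (n1 : n = 1%N) (j k : 'I_n) : j = k.
Proof. by case: _ / (esym n1) in j k *; rewrite !ord1. Qed.

Lemma alt_spec_true (b b' : bool) (T : Type) (f : b -> T) (g : ~~ b -> T)
    (p : alt_spec b b b') (h : b) :
  match p with AltTrue h' => f h' | AltFalse h' => g h' end = f h.
Proof.
by case: p => h'; [rewrite (bool_irrelevance h' h) | have := h'; rewrite h].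
Qed.

Lemma alt_spec_false (b b' : bool) (T : Type) (f : b -> T) (g : ~~ b -> T)
    (p : alt_spec b b b') (h : ~~ b) :
  match p with AltTrue h' => f h' | AltFalse h' => g h' end = g h.
Proof.
by case: p => h'; [have := h; rewrite h' | rewrite (bool_irrelevance h' h)].
Qed.

Lemma merge_lt i (a : row_index d i) (b : col_index d i) (k : 'I_N) (h : (k < i)%N) :
  merge_index a b k = a (exist _ k h).
Proof. by rewrite ffunE (alt_spec_true _ _ _ h). Qed.

Lemma merge_ge i (a : row_index d i) (b : col_index d i) (k : 'I_N) (h : ~~ (k < i)%N) :
  merge_index a b k = b (exist _ k h).
Proof. by rewrite ffunE (alt_spec_false _ _ _ h). Qed.

Definition restr_row i (s : mindex d) : row_index d i := [ffun k => s (val k)].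
Definition restr_col i (s : mindex d) : col_index d i := [ffun k => s (val k)].

Lemma merge_restr_lt i s (b : col_index d i) (k : 'I_N) : (k < i)%N ->
  merge_index (restr_row i s) b k = s k.
Proof. by move=> h; rewrite merge_lt ffunE. Qed.

Lemma merge_restr_ge i (a : row_index d i) s (k : 'I_N) : (i <= k)%N ->
  merge_index a (restr_col i s) k = s k.
Proof. by rewrite leqNgt => h; rewrite merge_ge ffunE. Qed.

Lemma merge_restr i s : merge_index (restr_row i s) (restr_col i s) = s.
Proof.
apply/ffunP => k; have [h|h] := ltnP k i.
  by rewrite merge_restr_lt.
by rewrite merge_restr_ge.
Qed.

Lemma restr_row_merge i (a : row_index d i) (b : col_index d i) :
  restr_row i (merge_index a b) = a.
Proof. by apply/ffunP => -[k h]; rewrite ffunE /= merge_lt. Qed.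

Lemma restr_col_merge i (a : row_index d i) (b : col_index d i) :
  restr_col i (merge_index a b) = b.
Proof. by apply/ffunP => -[k h]; rewrite ffunE /= merge_ge. Qed.

Lemma sum_merge i (V : nmodType) (F : mindex d -> V) :
  \sum_s F s = \sum_(a : row_index d i) \sum_(b : col_index d i) F (merge_index a b).
Proof.
rewrite pair_big /= (reindex (fun p : row_index d i * col_index d i => merge_index p.1 p.2)) //=.
exists (fun s => (restr_row i s, restr_col i s)) => [[a b]|s] _ /=.
  by rewrite restr_row_merge restr_col_merge.
by rewrite merge_restr.
Qed.

Lemma sum_enum_val (T : finType) (V : nmodType) (F : T -> V) :
  \sum_(i < #|T|) F (enum_val i) = \sum_x F x.
Proof.
rewrite [RHS](reindex (@enum_val T (mem T))) /=; last exact/onW_bij/enum_val_bij.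
by apply: eq_bigl.
Qed.

Definition tdot (T T' : tensor R d) : R := \sum_s T s * T' s.

Lemma fdot_unfolding i (T T' : tensor R d) :
  fdot (unfolding T i) (unfolding T' i) = tdot T T'.
Proof.
rewrite /tdot (sum_merge i) -sum_enum_val; apply: eq_bigr => a _.
by rewrite -sum_enum_val; apply: eq_bigr => b _; rewrite !mxE.
Qed.

Lemma tt_prod_local X B s s' m (h h' : (m <= N)%N) :
  (forall k : 'I_N, (k < m)%N -> X k (s k) = B k (s' k)) ->
  tt_prod X s h = tt_prod B s' h'.
Proof.
elim: m h h' => [//|m IH] h h' E /=.
rewrite (bool_irrelevance h' h); congr (_ *m _).
  by apply: IH => k km; apply: E; rewrite ltnS ltnW.
exact: (E (Ordinal h) (ltnSn m)).
Qed.

Lemma tail_lt k n : (k + n.+1 = N)%N -> (k < N)%N.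
Proof. by move=> <-; rewrite addnS ltnS leq_addr. Qed.

Lemma tail_eq k n : (k + n.+1 = N)%N -> (k.+1 + n = N)%N.
Proof. by rewrite addSnnS. Qed.

Fixpoint tt_tail_rec X s (n : nat) : forall k, (k + n = N)%N -> 'cV[R]_(rk N r k) :=
  match n with
  | 0 => fun _ _ => const_mx 1
  | m.+1 => fun k e =>
      X (Ordinal (tail_lt e)) (s (Ordinal (tail_lt e))) *m tt_tail_rec X s (tail_eq e)
  end.

(* X_k(s_k) ... X_(N-1)(s_(N-1)); since the last rank is 1, starting from the
   all-ones column avoids a cast. *)
Definition tt_tail X s k (h : (k <= N)%N) : 'cV[R]_(rk N r k) :=
  tt_tail_rec X s (subnKC h).

Lemma tt_tail_recE X s n k (e : (k + n = N)%N) (h : (k <= N)%N) :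
  tt_tail_rec X s e = tt_tail X s h.
Proof.
rewrite /tt_tail; move: (subnKC h) => e'.
have E : (N - k = n)%N by rewrite -e addKn.
by case: _ / E in e e' *; rewrite (eq_irrelevance e e').
Qed.

Lemma tt_tail_last X s : tt_tail X s (leqnn N) = const_mx 1.
Proof. by rewrite -(tt_tail_recE X s (addn0 N)). Qed.

Lemma tt_tailS X s (i : 'I_N) :
  tt_tail X s (ltnW (ltn_ord i)) = X i (s i) *m tt_tail X s (ltn_ord i).
Proof.
have e : (i + (N - i.+1).+1 = N)%N by rewrite -subSn ?ltn_ord // subSS subnKC // ltnW.
rewrite -(tt_tail_recE X s e) /= (tt_tail_recE X s (tail_eq e) (ltn_ord i)).
by case: i e => k h /= e; rewrite (bool_irrelevance (tail_lt e) h).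
Qed.

Lemma tt_prodS X s (i : 'I_N) :
  tt_prod X s (ltn_ord i) = tt_prod X s (ltnW (ltn_ord i)) *m X i (s i).
Proof.
by case: i => k h; rewrite /= (bool_irrelevance (ltn_ord (Ordinal h)) h).
Qed.

(** The bounds appear as [ltn_ord i] and [ltnW (ltn_ord i)], the shapes used in [tt_tailS] and
    [tt_prodS], so that inductions never have to transport a dependent type along a bound. *)
Lemma ord_down_ind (P : forall k, (k <= N)%N -> Prop) :
  P N (leqnn N) ->
  (forall i : 'I_N, P i.+1 (ltn_ord i) -> P i (ltnW (ltn_ord i))) ->
  forall k h, P k h.
Proof.
move=> PN PS k h; have [n e] : exists n, (n + k = N)%N by exists (N - k)%N; rewrite subnK.
elim: n k h e => [|n IH] k h e.
  rewrite add0n in e; case: _ / (esym e) in h *.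
  by rewrite (bool_irrelevance h (leqnn N)).
have kN : (k < N)%N by rewrite -e addSn ltnS leq_addl.
have := PS (Ordinal kN); rewrite /= => PSk.
rewrite (bool_irrelevance h (ltnW (ltn_ord (Ordinal kN)))); apply: PSk.
by apply: IH; rewrite addnS -addSn.
Qed.

Lemma tt_tail_local X B s s' k (h : (k <= N)%N) :
  (forall i : 'I_N, (k <= i)%N -> X i (s i) = B i (s' i)) ->
  tt_tail X s h = tt_tail B s' h.
Proof.
move: k h; apply: ord_down_ind => [_|i IH E]; first by rewrite !tt_tail_last.
by rewrite !tt_tailS E // IH // => j ij; apply: E; apply: ltnW.
Qed.

(** At level N the tail is the 1 x 1 all-ones column; each step down moves one slice from the
    product to the tail. *)
Lemma tt_split X s k (h : (k <= N)%N) : tt X s = (tt_prod X s h *m tt_tail X s h) 0 0.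
Proof.
move: k h; apply: ord_down_ind => [|i IH].
  rewrite tt_tail_last /tt mxE.
  rewrite (bigD1 (cast_ord (esym (rk_last N r)) ord0)) //= big1 => [|j].
    by rewrite addr0 mxE mulr1.
  have := ltn_ord j; rewrite [X in (_ < X)%N]rk_last ltnS leqn0 => /eqP j0.
  by move/eqP; case; apply: val_inj.
by rewrite IH tt_tailS mulmxA -tt_prodS.
Qed.

Lemma tt_dfwith X (i : 'I_N) (V : 'I_(d i) -> 'M[R]_(rk N r i, rk N r i.+1)) s :
  tt (@dfwith _ _ X i V) s =
  (tt_prod X s (ltnW (ltn_ord i)) *m V (s i) *m tt_tail X s (ltn_ord i)) 0 0.
Proof.
rewrite (tt_split _ s (ltn_ord i)) tt_prodS dfwithin.
congr (fun_of_matrix (_ *m _ *m _) _ _).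
  by apply: tt_prod_local => k ki; rewrite dfwithout // gt_eqF.
by apply: tt_tail_local => k ki; rewrite dfwithout // lt_eqF.
Qed.

(* The matrices with unfolding (tt X) k = left_mx X k *m right_mx X k.  The base
   index s0 only fills the coordinates on which the entries do not depend. *)
Variable s0 : mindex d.

Definition left_mx X k (h : (k <= N)%N) : 'M[R]_(#|row_index d k|, rk N r k) :=
  \matrix_(a, j) tt_prod X (merge_index (enum_val a) (restr_col k s0)) h 0 j.

Definition right_mx X k (h : (k <= N)%N) : 'M[R]_(rk N r k, #|col_index d k|) :=
  \matrix_(j, b) tt_tail X (merge_index (restr_row k s0) (enum_val b)) h j 0.

Lemma left_mxE X k (h : (k <= N)%N) a j :
  left_mx X h a j = tt_prod X (merge_index (enum_val a) (restr_col k s0)) h 0 j.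
Proof. by rewrite mxE. Qed.

Lemma right_mxE X k (h : (k <= N)%N) j b :
  right_mx X h j b = tt_tail X (merge_index (restr_row k s0) (enum_val b)) h j 0.
Proof. by rewrite mxE. Qed.

Lemma unfolding_tt X k (h : (k <= N)%N) : unfolding (tt X) k = left_mx X h *m right_mx X h.
Proof.
apply/matrixP => a b; rewrite mxE (tt_split _ _ h) !mxE.
apply: eq_bigr => j _; rewrite left_mxE right_mxE; congr (_ * _); congr (fun_of_matrix _ _ _).
  by apply: tt_prod_local => l lk; rewrite !merge_lt.
apply: tt_tail_local => l; rewrite leqNgt => lk; by rewrite !merge_ge.
Qed.

Lemma left_mx_local X B k (h : (k <= N)%N) :
  (forall i : 'I_N, (i < k)%N -> X i = B i) -> left_mx X h = left_mx B h.
Proof.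
move=> E; apply/matrixP => a j; rewrite ?left_mxE ?right_mxE; congr (fun_of_matrix _ _ _).
by apply: tt_prod_local => i ik; rewrite E.
Qed.

Lemma right_mx_local X B k (h : (k <= N)%N) :
  (forall i : 'I_N, (k <= i)%N -> X i = B i) -> right_mx X h = right_mx B h.
Proof.
move=> E; apply/matrixP => a j; rewrite ?left_mxE ?right_mxE; congr (fun_of_matrix _ _ _).
by apply: tt_tail_local => i ik; rewrite E.
Qed.

(** * Appending one mode to the left part *)

Section Extension.
Variable i : 'I_N.

(** Row indices are dependent functions on a subtype of the modes, so dropping or appending a
    coordinate passes through a full multi-index completed by [s0]. *)
Definition row_init (a : row_index d i.+1) : row_index d i :=
  restr_row i (merge_index a (restr_col i.+1 s0)).
Definition row_last (a : row_index d i.+1) : 'I_(d i) :=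
  merge_index a (restr_col i.+1 s0) i.
Definition row_rcons (a : row_index d i) (x : 'I_(d i)) : row_index d i.+1 :=
  restr_row i.+1 [ffun k => @dfwith _ (fun k => 'I_(d k)) (merge_index a (restr_col i s0)) i x k].

Lemma row_rconsK a x : row_init (row_rcons a x) = a.
Proof.
apply/ffunP => -[k h]; rewrite ffunE /= merge_restr_lt; last by rewrite ltnS ltnW.
by rewrite ffunE dfwithout ?merge_lt // gt_eqF.
Qed.

Lemma row_last_rcons a x : row_last (row_rcons a x) = x.
Proof. by rewrite /row_last merge_restr_lt // ffunE dfwithin. Qed.

Lemma row_rcons_init a : row_rcons (row_init a) (row_last a) = a.
Proof.
apply/ffunP => -[k h]; rewrite ffunE /= ffunE.
have [E|ki] := eqVneq k i.
  by case: _ / (esym E) in h *; rewrite dfwithin /row_last merge_lt.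
have kli : (k < i)%N by rewrite ltn_neqAle -ltnS h andbT.
rewrite dfwithout 1?eq_sym // /row_init merge_restr_lt // merge_lt //.
Qed.

Lemma sum_row_rcons (V : nmodType) (F : row_index d i.+1 -> V) :
  \sum_a F a = \sum_a \sum_x F (row_rcons a x).
Proof.
rewrite pair_big /= (reindex (fun p => row_rcons p.1 p.2)) //=.
exists (fun a => (row_init a, row_last a)) => [[a x]|a] _ /=.
  by rewrite row_rconsK row_last_rcons.
by rewrite row_rcons_init.
Qed.

Variables p q : nat.
Implicit Types (D : 'M[R]_(#|row_index d i|, p)) (Y : 'I_(d i) -> 'M[R]_(p, q)).

(* Row (s_0, ..., s_i) of [ext D Y] is row (s_0, ..., s_(i-1)) of D times Y(s_i). *)
Definition ext D Y : 'M[R]_(#|row_index d i.+1|, q) :=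
  \matrix_(a, j) (row (enum_rank (row_init (enum_val a))) D *m Y (row_last (enum_val a))) 0 j.

Lemma extBl D D' Y : ext (D - D') Y = ext D Y - ext D' Y.
Proof. by apply/matrixP => a j; rewrite !mxE -sumrB; apply: eq_bigr => k _; rewrite !mxE; ring. Qed.

Lemma extBr D Y Y' : ext D (fun x => Y x - Y' x) = ext D Y - ext D Y'.
Proof. by apply/matrixP => a j; rewrite !mxE -sumrB; apply: eq_bigr => k _; rewrite !mxE; ring. Qed.

Lemma ext_gram D D' Y Y' :
  (ext D Y)^T *m ext D' Y' = \sum_x (Y x)^T *m (D^T *m D') *m Y' x.
Proof.
apply/matrixP => j k; rewrite !mxE summxE.
under eq_bigr do rewrite !mxE.
rewrite (sum_enum_val (fun a => (\sum_l row (enum_rank (row_init a)) D 0 l * Y (row_last a) l j) *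
  (\sum_l row (enum_rank (row_init a)) D' 0 l * Y' (row_last a) l k))).
rewrite sum_row_rcons exchange_big /=; apply: eq_bigr => x _.
under eq_bigr do rewrite row_rconsK row_last_rcons.
rewrite -(sum_enum_val (fun a => (\sum_l row (enum_rank a) D 0 l * Y x l j) *
  (\sum_l row (enum_rank a) D' 0 l * Y' x l k))).
rewrite -mulmxA mulmxA -mulmxA -mulmxA [_ *m (_ *m (_ *m _))]mulmxA -trmx_mul.
rewrite mxE; apply: eq_bigr => a _; rewrite enum_valK !mxE.
by congr (_ * _); apply: eq_bigr => l _; rewrite !mxE.
Qed.

Lemma frob2_ext D Y : frob2 (ext D Y) = \sum_x frob2 (D *m Y x).
Proof.
rewrite frob2E fdotE ext_gram raddf_sum /=; apply: eq_bigr => x _.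
by rewrite frob2E fdotE trmx_mul !mulmxA.
Qed.

Lemma mxcol_gram Y Y' :
  (\mxcol_x Y x)^T *m (\mxcol_x Y' x) = \sum_x (Y x)^T *m Y' x.
Proof. by rewrite tr_mxcol mul_mxrow_mxcol. Qed.

Lemma frob2_mxcol Y : frob2 (\mxcol_x Y x) = \sum_x frob2 (Y x).
Proof.
rewrite frob2E fdotE mxcol_gram raddf_sum /=; apply: eq_bigr => x _.
by rewrite frob2E fdotE.
Qed.

Lemma ext_gram_isom D Y Y' : D^T *m D = 1%:M ->
  (ext D Y)^T *m ext D Y' = (\mxcol_x Y x)^T *m (\mxcol_x Y' x).
Proof.
move=> DD; rewrite ext_gram mxcol_gram; apply: eq_bigr => x _.
by rewrite DD mulmx1.
Qed.

Lemma frob2_ext_isom D Y : D^T *m D = 1%:M -> frob2 (ext D Y) = frob2 (\mxcol_x Y x).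
Proof. by move=> DD; rewrite !frob2E !fdotE ext_gram_isom. Qed.

Lemma frob2_ext_le D Y : frob2 (ext D Y) <= frob2 D * frob2 (\mxcol_x Y x).
Proof.
rewrite frob2_ext frob2_mxcol mulr_sumr; apply: ler_sum => x _.
exact: frob2_mulmx.
Qed.

End Extension.

Lemma left_mxS X (i : 'I_N) : left_mx X (ltn_ord i) = ext (left_mx X (ltnW (ltn_ord i))) (X i).
Proof.
apply/matrixP => a j; rewrite left_mxE [RHS]mxE tt_prodS !mxE; apply: eq_bigr => l _.
rewrite [in RHS]mxE left_mxE enum_rankK; congr (fun_of_matrix _ _ _ * _).
apply: tt_prod_local => k ki; rewrite merge_restr_lt //.
Qed.

Lemma left_mx0_gram X (h : (0 <= N)%N) : (left_mx X h)^T *m left_mx X h = 1%:M.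
Proof.
apply/matrixP => j k; rewrite mxE [RHS]mxE.
under eq_bigr => a _ do rewrite mxE !left_mxE /= !mxE.
rewrite sumr_const card_ord.
have -> : #|row_index d 0| = 1%N.
  rewrite -(card1 (restr_row 0 s0)); apply: eq_card => a; rewrite !inE.
  by apply/esym/eqP/ffunP => -[].
by rewrite (ord_eq1 erefl j 0) (ord_eq1 erefl k 0) mulr1.
Qed.

Lemma ord_up_ind (P : forall k, (k <= N)%N -> Prop) :
  P 0 (leq0n N) ->
  (forall i : 'I_N, P i (ltnW (ltn_ord i)) -> P i.+1 (ltn_ord i)) ->
  forall k h, P k h.
Proof.
move=> P0 PS; elim=> [|k IH] h; first by rewrite (bool_irrelevance h (leq0n N)).
by rewrite (bool_irrelevance h (ltn_ord (Ordinal h))); exact: (PS (Ordinal h) (IH _)).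
Qed.

Lemma left_mx_gramS X B (i : 'I_N) :
  let h := ltnW (ltn_ord i) in (left_mx X h)^T *m left_mx X h = 1%:M -> left_mx B h = left_mx X h ->
  (left_mx X (ltn_ord i))^T *m left_mx B (ltn_ord i) = (lunf X i)^T *m lunf B i.
Proof. by move=> h XX BX; rewrite !left_mxS BX ext_gram_isom. Qed.

(** Extending an isometric left part by a factor with orthonormal left unfolding keeps it isometric.
    The level stays below N because the last factor is not constrained. *)
Lemma left_mx_isom X k (h : (k <= N)%N) : left_orth X -> (k < N)%N ->
  (left_mx X h)^T *m left_mx X h = 1%:M.
Proof.
move=> lo; move: k h; apply: ord_up_ind => [_|i IH iN]; first exact: left_mx0_gram.
by rewrite left_mx_gramS ?IH ?(ltnW iN) //; apply: lo.
Qed.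



Lemma right_mx_last_isom X : right_mx X (leqnn N) *m (right_mx X (leqnn N))^T = 1%:M.
Proof.
apply/matrixP => j k; rewrite mxE [RHS]mxE.
under eq_bigr do rewrite right_mxE tt_tail_last mxE mul1r mxE right_mxE tt_tail_last mxE.
rewrite sumr_const card_ord.
have -> : #|col_index d N| = 1%N.
  rewrite -(card1 (restr_col N s0)); apply: eq_card => a; rewrite !inE.
  by apply/esym/eqP/ffunP => -[l h]; have := h; rewrite ltn_ord.
by rewrite (ord_eq1 (rk_last N r) j k) eqxx.
Qed.

(** Let u annihilate all tails at level i. Changing s_i alone does not affect the tail at level i +
    1, so by induction u X_i(x) = 0 for every x; thus u annihilates the right unfolding, which has
    full row rank. *)
Lemma right_mx_row_free X k (h : (k <= N)%N) :
  (forall i : 'I_N, \rank (runf X i) = rk N r i) -> row_free (right_mx X h).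
Proof.
move=> rkR.
have free : forall k h (u : 'rV[R]_(rk N r k)),
    (forall s, u *m tt_tail X s h = 0) -> u = 0.
  apply: ord_down_ind => [u u0|i IH u u0].
    apply/rowP => j; have /matrixP/(_ 0 0) := u0 s0; rewrite tt_tail_last !mxE.
    rewrite (bigD1 j) //= big1 ?addr0 => [|l]; first by rewrite mxE mulr1.
    by rewrite (ord_eq1 (rk_last N r) l j) eqxx.
  have uX x : u *m X i x = 0.
    apply: IH => s.
    pose s' : mindex d := [ffun k => @dfwith _ (fun k => 'I_(d k)) s i x k].
    have s'i : s' i = x by rewrite ffunE dfwithin.
    have <- : tt_tail X s' (ltn_ord i) = tt_tail X s (ltn_ord i).
      by apply: tt_tail_local => l il; rewrite ffunE dfwithout // lt_eqF.
    by have := u0 s'; rewrite tt_tailS s'i mulmxA.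
  have fr : row_free (runf X i) by rewrite /row_free rkR.
  apply: (row_free_inj fr); rewrite mul0mx /runf mul_mxrow.
  by apply/eqP; rewrite -mxrow0; apply/eqP/eq_mxrow => x; rewrite uX.
apply/inj_row_free => u uR; apply: (free _ h) => s.
apply/matrixP => a b; rewrite !ord1 [RHS]mxE.
have /rowP/(_ (enum_rank (restr_col k s))) := uR; rewrite !mxE => E.
rewrite -[RHS]E; apply: eq_bigr => l _; rewrite right_mxE enum_rankK; congr (_ * _).
congr (fun_of_matrix _ _ _); apply: tt_tail_local => i ki.
by rewrite merge_restr_ge.
Qed.

End TTStructure.

(** * Invariance under rotations of the factors *)

Section Rotation.
Variables (R : realType) (N : nat) (d : 'I_N -> nat) (r : nat -> nat).
Variables (Q : rotations R N r).
Implicit Types X : factors R d r.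
Hypothesis rotQ : is_rotations Q.

Let QQ k : (Q k)^T *m Q k = 1%:M. Proof. by have [h _ _] := rotQ. Qed.
Let QQt k : Q k *m (Q k)^T = 1%:M. Proof. exact: mulmx1C. Qed.

Lemma tt_prod_rotate X s  m (h : (m <= N)%N) :
  tt_prod (rotate Q X) s h = tt_prod X s h *m Q m.
Proof.
elim: m h => [|m IH] h /=; first by have [_ -> _] := rotQ; rewrite mulmx1.
by rewrite IH /rotate !mulmxA -(mulmxA _ (Q m)) QQt mulmx1.
Qed.

Lemma tt_rotate X : tt (rotate Q X) = tt X.
Proof.
apply/funext => s; rewrite /tt tt_prod_rotate.
by have [_ _ ->] := rotQ; rewrite mulmx1.
Qed.

Lemma left_mx_rotate X s0  k (h : (k <= N)%N) : left_mx s0 (rotate Q X) h = left_mx s0 X h *m Q k.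
Proof.
apply/matrixP => a j; rewrite left_mxE tt_prod_rotate !mxE; apply: eq_bigr => l _.
by rewrite left_mxE.
Qed.

Lemma left_orth_rotate X : left_orth X -> left_orth (rotate Q X).
Proof.
move=> lo i iN; have := lo i iN; rewrite !mxcol_gram => E.
have -> : \sum_(x < d i) (@rotate R N d r Q X i x)^T *m @rotate R N d r Q X i x =
    (Q i.+1)^T *m (\sum_(x < d i) (X i x)^T *m X i x) *m Q i.+1.
  rewrite mulmx_sumr mulmx_suml; apply: eq_bigr => x _.
  by rewrite /rotate !trmx_mul trmxK !mulmxA -(mulmxA _ (Q i) (Q i)^T) QQt mulmx1.
by rewrite E mulmx1 QQ.
Qed.

End Rotation.

(** * The gradient of the loss in one factor *)

Section Gradient.
Variables (R : realType) (N : nat) (d : 'I_N -> nat) (r : nat -> nat).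
Variables (T : tensor R d) (X : factors R d r) (i : 'I_N).

Let phi (Y : 'M[R]_(\sum_(s < d i) rk N r i, rk N r i.+1)) : tensor R d :=
  tt (@dfwith _ _ X i (fun s : 'I_(d i) => submxcol Y s)).

Lemma tt_dfwith_linear a Y Z s : phi (a *: Y + Z) s = a * phi Y s + phi Z s.
Proof.
rewrite /phi !tt_dfwith.
have -> : submxcol (a *: Y + Z) (s i) = a *: submxcol Y (s i) + submxcol Z (s i).
  by apply/matrixP => b c; rewrite !mxE.
by rewrite mulmxDr mulmxDl -scalemxAr -scalemxAl mxE [X in X + _ = _]mxE.
Qed.

Lemma tt_dfwith_sum (I : finType) (c : I -> R) F s :
  phi (\sum_j c j *: F j) s = \sum_j c j * phi (F j) s.
Proof.
have phi0 : phi 0 s = 0.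
  have := tt_dfwith_linear (-1) 0 0 s; rewrite scaler0 addr0; lra.
elim/big_ind2: _ => // [Y a Z b <- <-|j _].
  by rewrite -{1}[a]scale1r tt_dfwith_linear mul1r.
by rewrite -[X in phi X]addr0 tt_dfwith_linear phi0 addr0.
Qed.

(** The tensor is linear in a single factor, so the loss is quadratic along E and its difference
    quotient is exactly c + h e. *)
Lemma derive_tt_loss E :
  'D_E ((fun Y => tt_loss T (@dfwith _ _ X i (fun s : 'I_(d i) => submxcol Y s))) :
      'M[R]_(\sum_(s < d i) rk N r i, rk N r i.+1) -> R^o) (lunf X i) =
  tdot (fun s => tt X s - T s) (phi E).
Proof.
have phiX : phi (lunf X i) = tt X.
  apply/funext => s; rewrite /phi tt_dfwith mxcolK.
  by rewrite -mulmxA -tt_tailS -tt_split.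
set c := tdot _ _; pose e := 2^-1 * tdot (phi E) (phi E).
have expand h : tt_loss T (@dfwith _ _ X i (fun s : 'I_(d i) => submxcol (h *: E + lunf X i) s))
    - tt_loss T (@dfwith _ _ X i (fun s : 'I_(d i) => submxcol (lunf X i) s)) = h * (c + h * e).
  rewrite /tt_loss -/(phi (h *: E + lunf X i)) -/(phi (lunf X i)) phiX -mulrBr -sumrB.
  rewrite /c /e /tdot mulrDr !mulr_sumr -big_split /=; apply: eq_bigr => s _.
  by rewrite tt_dfwith_linear phiX; field.
rewrite /derive; apply: cvg_lim => //.
have lin : (fun h : R => c + h * e) @ 0^' --> c.
  rewrite -[X in _ --> X]addr0 -[X in _ + X](mul0r e).
  apply: cvgD; first exact: cvg_cst.
  apply: cvgMl; exact: cvg_within.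
apply: cvg_trans lin; apply: near_eq_cvg; near=> h.
rewrite /= expand /GRing.scale /= mulKf //.
by near: h; exact: nbhs_dnbhs_neq.
Unshelve. all: by end_near.
Qed.

(** [gradmx] only records derivatives along coordinate matrices; the linearity of [phi] extends the
    formula to every direction V. *)
Lemma fdot_grad_lunf V :
  fdot (grad_lunf (tt_loss T) X i) V = tdot (fun s => tt X s - T s) (phi V).
Proof.
have -> : phi V = fun s =>
    \sum_(p : 'I_(\sum_(s < d i) rk N r i) * 'I_(rk N r i.+1))
      V p.1 p.2 * phi (delta_mx p.1 p.2) s.
  apply/funext => s; rewrite -tt_dfwith_sum; congr (phi _ s).
  by rewrite {1}[V]matrix_sum_delta pair_big.
rewrite /fdot pair_big /= /tdot.
under [RHS]eq_bigr do rewrite mulr_sumr.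
rewrite exchange_big /=; apply: eq_bigr => p _.
rewrite mxE derive_tt_loss /tdot mulr_suml; apply: eq_bigr => s _.
by ring.
Qed.

End Gradient.

(** * Norm and inner product of tensors, read off any unfolding *)

Section TensorNorm.
Variables (R : realType) (N : nat) (d : 'I_N -> nat).
Implicit Types T : tensor R d.

Definition tnorm T : R := Num.sqrt (tdot T T).

Lemma fnorm_unfolding i T : fnorm (unfolding T i) = tnorm T.
Proof. by rewrite /fnorm frob2E fdot_unfolding. Qed.

Lemma unfoldingB i T T' :
  unfolding (fun s => T s - T' s) i = unfolding T i - unfolding T' i.
Proof. by apply/matrixP => a b; rewrite !mxE. Qed.

Lemma unfoldingD i T T' :
  unfolding (fun s => T s + T' s) i = unfolding T i + unfolding T' i.
Proof. by apply/matrixP => a b; rewrite !mxE. Qed.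

Lemma tnorm_ge0 T : 0 <= tnorm T.
Proof. exact: sqrtr_ge0. Qed.

Lemma sqr_tnorm T : tnorm T ^+ 2 = tdot T T.
Proof. by rewrite -(fnorm_unfolding 0) sqr_fnorm frob2E fdot_unfolding. Qed.

Lemma tdot_le T T' : tdot T T' <= tnorm T * tnorm T'.
Proof. by rewrite -(fdot_unfolding 0) -!(fnorm_unfolding 0) fdot_le. Qed.

Lemma tdot_ge T T' : - (tnorm T * tnorm T') <= tdot T T'.
Proof. by rewrite -(fdot_unfolding 0) -!(fnorm_unfolding 0) fdot_ge. Qed.

Lemma tnormD T T' : tnorm (fun s => T s + T' s) <= tnorm T + tnorm T'.
Proof. by rewrite -!(fnorm_unfolding 0) unfoldingD fnormD. Qed.

Lemma tdotDr T T' T'' : tdot T (fun s => T' s + T'' s) = tdot T T' + tdot T T''.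
Proof. by rewrite /tdot -big_split /=; apply: eq_bigr => s _; rewrite mulrDr. Qed.

Lemma tdot_sumr (I : finType) T (F : I -> tensor R d) :
  tdot T (fun s => \sum_i F i s) = \sum_i tdot T (F i).
Proof.
rewrite /tdot exchange_big /=; apply: eq_bigr => s _; exact: mulr_sumr.
Qed.

End TensorNorm.

Lemma sqr_sum_le (R : realType) N (p : 'I_N -> R) :
  (\sum_i p i) ^+ 2 <= N%:R * \sum_i p i ^+ 2.
Proof.
have := sqr_fdot_le (const_mx 1) (\row_i p i); rewrite /fdot /frob2 !big_ord1.
under eq_bigr do rewrite !mxE mul1r.
under [X in _ <= X * _]eq_bigr do rewrite mxE expr1n.
by under [X in _ <= _ * X]eq_bigr do rewrite mxE; rewrite sumr_const card_ord.
Qed.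

(** * One gradient step *)

Section Descent.
Variables (R : realType) (N : nat) (d : 'I_N -> nat) (r : nat -> nat).
Variables (s0 : mindex d) (T : tensor R d) (sb : R).
Variables (X B : factors R d r).
Hypothesis sb_gt0 : 0 < sb.
Hypothesis sbT : forall k, (0 < k < N)%N -> sing_val (unfolding T k) 1 <= sb.
Hypotheses (loX : left_orth X) (loB : left_orth B) (ttB : tt B = T).

(* One weight per factor puts the two sums of the distance in a single one. *)
Definition weight (i : 'I_N) : R := if (i.+1 < N)%N then sb else 1.

Lemma weight_gt0 i : 0 < weight i.
Proof. by rewrite /weight; case: ifP. Qed.

Let L := @left_mx R N d r s0.
Let Rt := @right_mx R N d r s0.
Let Y i := lunf X i - lunf B i.
Let D (i : 'I_N) := fun x : 'I_(d i) => @X i x - @B i x.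
Let p i := weight i * fnorm (Y i).
Let g : tensor R d := fun s => tt X s - T s.
Let y := tnorm g.

Let p_ge0 i : 0 <= p i.
Proof. by rewrite mulr_ge0 ?fnorm_ge0 // ltW ?weight_gt0. Qed.

Lemma lunfB_mxcol i : Y i = \mxcol_x D x.
Proof. by apply/matrixP => a b; rewrite !mxE. Qed.

Lemma right_mx_isom_last (Z : factors R d r) k (h : (k <= N)%N) : k = N ->
  Rt Z h *m (Rt Z h)^T = 1%:M.
Proof.
move=> kN; case: _ / (esym kN) in h *; rewrite (bool_irrelevance h (leqnn N)).
exact: right_mx_last_isom.
Qed.

Lemma fnorm_Rm_last (Z : factors R d r) (i : 'I_N) q (E : 'M[R]_(q, rk N r i.+1)) :
  (i.+1 < N)%N = false -> fnorm (E *m Rt Z (ltn_ord i)) = fnorm E.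
Proof.
move=> /negbT; rewrite -leqNgt => Ni; have iN : i.+1 = N by apply/eqP; rewrite eqn_leq ltn_ord Ni.
have E1 := right_mx_isom_last Z (ltn_ord i) iN.
have E2 : ((Rt Z (ltn_ord i))^T)^T *m (Rt Z (ltn_ord i))^T = 1%:M by rewrite trmxK.
by rewrite -[Rt Z _]trmxK fnorm_isomr.
Qed.

Lemma right_mxE_isom (Z : factors R d r) k (h : (k <= N)%N) : left_orth Z -> (k < N)%N ->
  Rt Z h = (L Z h)^T *m unfolding (tt Z) k.
Proof. by move=> lo kN; rewrite (unfolding_tt s0 Z h) mulmxA left_mx_isom // mul1mx. Qed.

Lemma unfolding_bound k q (E : 'M[R]_(q, _)) : (0 < k < N)%N ->
  fnorm (E *m unfolding T k) <= sb * fnorm E.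
Proof.
move=> kN; rewrite fnorm_le; last by rewrite mulr_ge0 ?fnorm_ge0 // ltW.
rewrite exprMn sqr_fnorm; apply: le_trans (sing_val1_mulmx _ _) _.
rewrite ler_wpM2r ?frob2_ge0 // ler_pXn2r ?nnegrE ?sing_val_ge0 ?sbT //.
exact: ltW.
Qed.

(** The right part of B is a transposed isometry times an unfolding of T, whose operator norm is at
    most [sb]. After the last factor the right part is the scalar 1; the two cases are the two
    values of [weight]. *)
Lemma right_mx_bound_ref (i : 'I_N) q (E : 'M[R]_(q, _)) :
  fnorm (E *m Rt B (ltn_ord i)) <= weight i * fnorm E.
Proof.
rewrite /weight; case: ifPn => iN; last first.
  by rewrite fnorm_Rm_last ?mul1r //; apply/negbTE.
rewrite right_mxE_isom // ttB mulmxA; apply: le_trans (unfolding_bound _ _) _.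
  by rewrite iN.
by rewrite fnorm_isomr // left_mx_isom.
Qed.

(** For X the unfolding is that of T plus the residual, whose operator norm is at most y <= sb / 2:
    hence 3 / 2. *)
Lemma right_mx_bound (i : 'I_N) q (E : 'M[R]_(q, _)) : y <= sb / 2 ->
  fnorm (E *m Rt X (ltn_ord i)) <= 3 / 2 * weight i * fnorm E.
Proof.
move=> hy; rewrite /weight; case: ifPn => iN; last first.
  rewrite fnorm_Rm_last; last exact/negbTE.
  by have := fnorm_ge0 E; lra.
have lo := left_mx_isom s0 (ltn_ord i) loX iN.
have -> : Rt X (ltn_ord i) = (L X (ltn_ord i))^T *m (unfolding T i.+1 + unfolding g i.+1).
  by rewrite right_mxE_isom // unfoldingB addrC subrK.
rewrite mulmxA mulmxDr; apply: le_trans (fnormD _ _) _.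
have h1 := @unfolding_bound i.+1 _ (E *m (L X (ltn_ord i))^T) iN.
have h2 := fnorm_mulmx (E *m (L X (ltn_ord i))^T) (unfolding g i.+1).
rewrite fnorm_unfolding fnorm_isomr // in h2; rewrite fnorm_isomr // in h1.
have := fnorm_ge0 E; move: h1 h2 hy; rewrite -/y; nra.
Qed.

Definition hybrid m : factors R d r := fun i => if (i < m)%N then @X i else @B i.
Arguments hybrid : clear implicits.

Lemma hybrid_lt m (i : 'I_N) : (i < m)%N -> hybrid m i = @X i.
Proof. by rewrite /hybrid => ->. Qed.

Lemma hybrid_ge m (i : 'I_N) : (m <= i)%N -> hybrid m i = @B i.
Proof. by rewrite /hybrid ltnNge => ->. Qed.

Lemma eq_tt (Z Z' : factors R d r) : (forall i : 'I_N, Z i = Z' i) -> tt Z = tt Z'.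
Proof.
move=> E; apply/funext => s; rewrite /tt; congr (fun_of_matrix _ _ _).
by apply: tt_prod_local => i _; rewrite E.
Qed.

Lemma fnorm_ext_X (i : 'I_N) : fnorm (ext s0 (L X (ltnW (ltn_ord i))) (@D i)) = fnorm (Y i).
Proof. by rewrite /fnorm frob2_ext_isom ?lunfB_mxcol // left_mx_isom. Qed.

(* Only factor i differs, so the difference is ext (left part) (X_i - B_i) times the
   right part of B, whose operator norm is at most [weight i]. *)
Lemma hybrid_step (i : 'I_N) : tnorm (fun s => tt (hybrid i.+1) s - tt (hybrid i) s) <= p i.
Proof.
rewrite -(fnorm_unfolding i.+1) unfoldingB !(unfolding_tt s0 _ (ltn_ord i)).
have -> : right_mx s0 (hybrid i.+1) (ltn_ord i) = Rt B (ltn_ord i).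
  by apply: right_mx_local => j ij; rewrite hybrid_ge.
have -> : right_mx s0 (hybrid i) (ltn_ord i) = Rt B (ltn_ord i).
  by apply: right_mx_local => j ij; rewrite hybrid_ge // ltnW.
rewrite -mulmxBl; apply: le_trans (right_mx_bound_ref _) _.
rewrite ler_pM2l ?weight_gt0 // !left_mxS.
have -> : left_mx s0 (hybrid i.+1) (ltnW (ltn_ord i)) = L X (ltnW (ltn_ord i)).
  by apply: left_mx_local => j ij; rewrite hybrid_lt // ltnS ltnW.
have -> : left_mx s0 (hybrid i) (ltnW (ltn_ord i)) = L X (ltnW (ltn_ord i)).
  by apply: left_mx_local => j ij; rewrite hybrid_lt.
rewrite hybrid_lt // hybrid_ge // -extBr.
by rewrite fnorm_ext_X.
Qed.

Lemma hybrid_tail k : (k <= N)%N ->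
  tnorm (fun s => tt X s - tt (hybrid k) s) <= \sum_(j < N | (k <= j)%N) p j.
Proof.
move: k; apply: ord_down_ind => [|i IH].
  have -> : tt (hybrid N) = tt X by apply: eq_tt => i; rewrite hybrid_lt.
  rewrite (_ : (fun _ => _) = fun=> 0); last by apply/funext => s; rewrite subrr.
  rewrite /tnorm /tdot big1 => [|s _]; last by rewrite mulr0.
  by rewrite sqrtr0 sumr_ge0.
rewrite (bigD1 i) //=; under eq_bigl => j do rewrite eq_sym andbC -ltn_neqAle.
rewrite [leRHS]addrC; apply: le_trans (lerD IH (hybrid_step i)).
apply: le_trans (tnormD _ _); rewrite le_eqVlt; apply/orP; left; apply/eqP.
by congr tnorm; apply/funext => s; rewrite addrA subrK.
Qed.

Lemma tnorm_g_le : y <= \sum_j p j.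
Proof.
have := @hybrid_tail 0 (leq0n N); rewrite (eq_tt (Z := hybrid 0) (Z' := B)) ?ttB //.
Qed.

Lemma sqr_tnorm_g_le : y ^+ 2 <= N%:R * \sum_j p j ^+ 2.
Proof.
apply: le_trans (sqr_sum_le _); rewrite ler_pXn2r ?nnegrE ?tnorm_ge0 ?tnorm_g_le //.
exact: sumr_ge0.
Qed.

(** Multiplying by the isometric left part of X turns the difference into that of [tt X] and a
    hybrid, where only the factors after i have been exchanged. *)
Lemma right_mx_diff (i : 'I_N) :
  fnorm (Rt X (ltn_ord i) - Rt B (ltn_ord i)) <= \sum_(j < N | (i < j)%N) p j.
Proof.
case: (boolP (i.+1 < N)%N) => iN; last first.
  have -> : Rt X (ltn_ord i) = Rt B (ltn_ord i).
    apply: right_mx_local => j ij; exfalso; move/negP: iN; apply.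
    exact: leq_ltn_trans ij (ltn_ord j).
  by rewrite subrr fnorm0 sumr_ge0.
rewrite -(fnorm_isom _ (left_mx_isom s0 (ltn_ord i) loX iN)) mulmxBr -unfolding_tt.
have -> : left_mx s0 X (ltn_ord i) *m Rt B (ltn_ord i) = unfolding (tt (hybrid i.+1)) i.+1.
  rewrite (unfolding_tt s0 _ (ltn_ord i)); congr (_ *m _).
    by apply: left_mx_local => j ij; rewrite hybrid_lt.
  by apply: right_mx_local => j ij; rewrite hybrid_ge.
by rewrite -unfoldingB fnorm_unfolding; apply: hybrid_tail.
Qed.

Definition tt_at (i : 'I_N) (V : 'I_(d i) -> 'M[R]_(rk N r i, rk N r i.+1)) : tensor R d :=
  tt (@dfwith _ _ X i V).

Lemma unfolding_tt_at (i : 'I_N) V :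
  unfolding (@tt_at i V) i.+1 = ext s0 (L X (ltnW (ltn_ord i))) V *m Rt X (ltn_ord i).
Proof.
rewrite (unfolding_tt s0 _ (ltn_ord i)) left_mxS dfwithin; congr (ext _ _ _ *m _).
  by apply: left_mx_local => j ji; rewrite dfwithout // gt_eqF.
by apply: right_mx_local => j ij; rewrite dfwithout // lt_eqF.
Qed.

Lemma tt_at_bound (i : 'I_N) V : y <= sb / 2 ->
  tnorm (@tt_at i V) <= 3 / 2 * weight i * fnorm (\mxcol_x V x).
Proof.
move=> hy; rewrite -(fnorm_unfolding i.+1) unfolding_tt_at.
apply: le_trans (right_mx_bound _ hy) _; rewrite /fnorm frob2_ext_isom //.
exact: left_mx_isom.
Qed.

(* Second-order error: Delta_i in front of X_(i+1) ... X_(N-1) rather than in front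
   of B_(i+1) ... B_(N-1). *)
Let remainder (i : 'I_N) : tensor R d :=
  fun s => tt_at (@D i) s - (tt (hybrid i.+1) s - tt (hybrid i) s).

(** Both tensors have the same left part, of norm |Y_i|, so only the difference of the right parts
    remains. For an inner factor, [sb] times |Y_i| is p_i; the last factor has weight 1, but nothing
    follows it and its remainder vanishes. *)
Lemma remainder_bound i : sb * tnorm (remainder i) <= p i * \sum_j p j.
Proof.
have h : tnorm (remainder i) <= fnorm (Y i) * \sum_(j < N | (i < j)%N) p j.
  rewrite -(fnorm_unfolding i.+1) !unfoldingB unfolding_tt_at.
  have -> : unfolding (tt (hybrid i.+1)) i.+1 - unfolding (tt (hybrid i)) i.+1 =
      ext s0 (L X (ltnW (ltn_ord i))) (@D i) *m Rt B (ltn_ord i).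
    rewrite !(unfolding_tt s0 _ (ltn_ord i)).
    have -> : right_mx s0 (hybrid i.+1) (ltn_ord i) = Rt B (ltn_ord i).
      by apply: right_mx_local => j ij; rewrite hybrid_ge.
    have -> : right_mx s0 (hybrid i) (ltn_ord i) = Rt B (ltn_ord i).
      by apply: right_mx_local => j ij; rewrite hybrid_ge // ltnW.
    rewrite -mulmxBl !left_mxS.
    have -> : left_mx s0 (hybrid i.+1) (ltnW (ltn_ord i)) = L X (ltnW (ltn_ord i)).
      by apply: left_mx_local => j ij; rewrite hybrid_lt // ltnS ltnW.
    have -> : left_mx s0 (hybrid i) (ltnW (ltn_ord i)) = L X (ltnW (ltn_ord i)).
      by apply: left_mx_local => j ij; rewrite hybrid_lt.
    by rewrite hybrid_lt // hybrid_ge // -extBr.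
  rewrite -mulmxBr; apply: le_trans (fnorm_mulmx _ _) _.
  by rewrite fnorm_ext_X ler_wpM2l ?fnorm_ge0 ?right_mx_diff.
case: (boolP (i.+1 < N)%N) => iN; last first.
  have E : \sum_(j < N | (i < j)%N) p j = 0.
    rewrite big1 // => j ij; exfalso; move/negP: iN; apply.
    exact: leq_ltn_trans ij (ltn_ord j).
  rewrite E mulr0 in h; have := tnorm_ge0 (remainder i) => h0.
  have -> : tnorm (remainder i) = 0 by apply/eqP; rewrite eq_le h h0.
  by rewrite mulr0 mulr_ge0 ?sumr_ge0.
rewrite {1}/p /weight iN -mulrA ler_pM2l //; apply: le_trans h _.
rewrite ler_wpM2l ?fnorm_ge0 //.
rewrite [leRHS](bigID (fun j : 'I_N => (i < j)%N)) /= lerDl sumr_ge0 //.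
Qed.

Lemma sum_tt_at s : \sum_i tt_at (@D i) s = g s + \sum_i remainder i s.
Proof.
rewrite /remainder sumrB.
suff -> : \sum_(i < N) (tt (hybrid i.+1) s - tt (hybrid i) s) = g s by rewrite addrC subrK.
rewrite -(big_mkord xpredT (fun i => tt (hybrid i.+1) s - tt (hybrid i) s)) telescope_sumr //.
rewrite (eq_tt (Z := hybrid N) (Z' := X)); last by move=> i; rewrite hybrid_lt.
by rewrite (eq_tt (Z := hybrid 0) (Z' := B)) ?ttB // => i; rewrite hybrid_ge.
Qed.

Let G i := grad_lunf (tt_loss T) X i.
Let PG (i : 'I_N) := if (i.+1 < N)%N then stiefel_proj (lunf X i) (G i) else G i.

Lemma fdot_G i V : fdot (G i) V = tdot g (tt_at (fun s => submxcol V s)).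
Proof. exact: fdot_grad_lunf. Qed.

Lemma fdot_G_bound i V : y <= sb / 2 -> fdot (G i) V <= 3 / 2 * weight i * y * fnorm V.
Proof.
move=> hy; rewrite fdot_G; apply: le_trans (tdot_le _ _) _.
have := tt_at_bound (fun s => submxcol V s) hy; rewrite submxcolK.
have := tnorm_ge0 g; rewrite -/y; nra.
Qed.

(** Duality: |PG|^2 = <G, PG>, so it suffices to bound G in the direction PG. *)
Lemma fnorm_PG i : y <= sb / 2 -> fnorm (PG i) <= 3 / 2 * weight i * y.
Proof.
move=> hy; have h : frob2 (PG i) = fdot (G i) (PG i).
  rewrite /PG; case: ifP => // iN; rewrite frob2_stiefel_proj //.
  exact: loX.
have [->|n0] := eqVneq (fnorm (PG i)) 0.
  by rewrite !mulr_ge0 ?tnorm_ge0 // ltW ?weight_gt0.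
have np : 0 < fnorm (PG i) by rewrite lt_def n0 fnorm_ge0.
rewrite -(ler_pM2r np) -expr2 sqr_fnorm h; exact: fdot_G_bound.
Qed.

(* On the Stiefel manifold P(Y - B) = (Y - B) - Y (Y - B)^T (Y - B) / 2: the projection
   only costs a second-order term. *)
Lemma fdot_PG i : y <= sb / 2 ->
  sb * tdot g (tt_at (@D i)) - 3 / 4 * y * p i ^+ 2 <= sb * fdot (PG i) (Y i).
Proof.
move=> hy.
have GY : fdot (G i) (Y i) = tdot g (tt_at (@D i)).
  rewrite fdot_G lunfB_mxcol; congr (tdot g (tt_at _)); apply/funext => x.
  by rewrite mxcolK.
have y0 : 0 <= y := tnorm_ge0 g.
rewrite /PG /p /weight; case: ifP => iN; last first.
  rewrite GY; have : 0 <= y * (1 * fnorm (Y i)) ^+ 2 by rewrite mulr_ge0 ?sqr_ge0.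
  lra.
rewrite stiefel_proj_selfadj.
rewrite /Y stiefel_proj_diff; [|exact: loX|exact: loB]; rewrite -/(Y i).
rewrite fdotBr GY fdotZr.
(* The factor 1 / 2 of the projection formula halves the 3 / 2 of this bound into the 3 / 4 of the
   statement. *)
have h := fdot_G_bound (lunf X i *m ((Y i)^T *m Y i)) hy.
have : fnorm (lunf X i *m ((Y i)^T *m Y i)) <= fnorm (Y i) ^+ 2.
  rewrite fnorm_isom; last exact: loX.
  apply: le_trans (fnorm_mulmx _ _) _.
  by rewrite {1}/fnorm frob2_tr -expr2.
move: h; rewrite /weight iN; set z := fnorm _; set q := fdot _ _ => h h2.
have : sb * y * z <= sb * y * fnorm (Y i) ^+ 2 by rewrite ler_wpM2l // mulr_ge0 // ltW.
have : sb * q <= sb * (3 / 2 * sb * y * z) by rewrite ler_pM2l.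
rewrite exprMn; have := sb_gt0.
set f := fnorm (Y i) ^+ 2 => *.
have : sb * (sb * y * z) <= sb * (sb * y * f) by rewrite ler_pM2l.
lra.
Qed.

Variables (mu : R) (X' : factors R d r).
Hypothesis mu_gt0 : 0 < mu.
Hypothesis stepX : forall i : 'I_N, lunf X' i =
  if (i.+1 < N)%N then
    polar_retr (lunf X i - (mu / sb ^+ 2) *: stiefel_proj (lunf X i) (G i))
  else lunf X i - mu *: G i.

Lemma left_orth_step : left_orth X'.
Proof.
move=> i iN; rewrite stepX iN.
apply: (polar_retr_nonexp (loB iN) _).1 => v.
exact: stiefel_step_expand (loX iN) _ _ _.
Qed.

Lemma frob2_step i :
  frob2 (lunf X' i - lunf B i) <= frob2 (Y i - (mu / weight i ^+ 2) *: PG i).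
Proof.
rewrite stepX /PG /weight /Y addrAC; case: ifP => iN; last first.
  by rewrite expr1n divr1.
apply: (polar_retr_nonexp (loB iN) _).2 => v.
exact: stiefel_step_expand (loX iN) _ _ _.
Qed.

(** The step size of factor i is mu / w_i^2. After multiplication by the weight w_i^2 of the
    distance, the linear term is 2 mu <PG_i, Y_i> for every i, and the quadratic term is at most 9/4
    mu^2 y^2 whatever the weight. *)
Lemma descent : y <= sb / 2 -> mu * (9 * N%:R) <= 2 ->
  \sum_i weight i ^+ 2 * frob2 (lunf X' i - lunf B i) <=
  \sum_i p i ^+ 2 - 3 / 2 * mu * y ^+ 2
    + (2 * N%:R + 3 / 2) * mu * y * (\sum_i p i ^+ 2) / sb.
Proof.
move=> hy hmu; have y0 : 0 <= y := tnorm_ge0 g.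
have step i : weight i ^+ 2 * frob2 (lunf X' i - lunf B i) <=
    p i ^+ 2 - 2 * mu * fdot (PG i) (Y i) + 9 / 4 * mu ^+ 2 * y ^+ 2.
  have wp := weight_gt0 i.
  apply: (@le_trans _ _ (weight i ^+ 2 * frob2 (Y i - (mu / weight i ^+ 2) *: PG i))).
    by rewrite ler_wpM2l ?sqr_ge0 ?frob2_step.
  have pE : p i ^+ 2 = weight i ^+ 2 * frob2 (Y i) by rewrite exprMn sqr_fnorm.
  rewrite pE frob2B fdotZr frob2Z fdotC.
  have h : frob2 (PG i) <= (3 / 2 * weight i * y) ^+ 2.
    rewrite -fnorm_le ?fnorm_PG // !mulr_ge0 //; exact: ltW.
  have -> : weight i ^+ 2 * (frob2 (Y i) - 2 * (mu / weight i ^+ 2 * fdot (PG i) (Y i)) +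
      (mu / weight i ^+ 2) ^+ 2 * frob2 (PG i)) =
    weight i ^+ 2 * frob2 (Y i) - 2 * mu * fdot (PG i) (Y i) + mu ^+ 2 / weight i ^+ 2 * frob2 (PG i).
    by field; rewrite gt_eqF.
  rewrite lerD2l.
  have -> : 9 / 4 * mu ^+ 2 * y ^+ 2 = mu ^+ 2 / weight i ^+ 2 * (3 / 2 * weight i * y) ^+ 2.
    by field; rewrite gt_eqF.
  by rewrite ler_wpM2l // divr_ge0 ?sqr_ge0.
apply: le_trans (ler_sum _ (fun i _ => step i)) _.
set a := \sum_i p i ^+ 2.
rewrite !big_split /= sumrN -mulr_sumr sumr_const card_ord -/a.
set F := \sum_i fdot _ _.
(* The N stems from the remainders through (sum p_j)^2 <= N a, the 3 / 4 from the projection. *)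
have hF : sb * y ^+ 2 - (N%:R + 3 / 4) * y * a <= sb * F.
  have h1 : sb * \sum_i tdot g (tt_at (@D i)) - 3 / 4 * y * a <= sb * F.
    rewrite /F /a !mulr_sumr -sumrB; apply: ler_sum => i _; exact: fdot_PG.
  have h2 : \sum_i tdot g (tt_at (@D i)) = y ^+ 2 + \sum_i tdot g (remainder i).
    rewrite -!tdot_sumr sqr_tnorm -tdotDr; congr (tdot g _); apply/funext => s.
    exact: sum_tt_at.
  have h3 : - (y * (\sum_j p j) ^+ 2) <= sb * \sum_i tdot g (remainder i).
    rewrite mulr_sumr expr2 mulr_suml mulr_sumr -sumrN; apply: ler_sum => i _.
    have := tdot_ge g (remainder i); have := remainder_bound i; rewrite -/y => ha hb.
    have : sb * (- (y * tnorm (remainder i))) <= sb * tdot g (remainder i) by rewrite ler_pM2l.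
    have : y * (sb * tnorm (remainder i)) <= y * (p i * \sum_j p j) by rewrite ler_wpM2l.
    lra.
  have h4 : y * (\sum_j p j) ^+ 2 <= y * (N%:R * a) by rewrite ler_wpM2l // sqr_sum_le.
  rewrite h2 in h1; move: h1 h3 h4; lra.
have hF' : y ^+ 2 - (N%:R + 3 / 4) * y * a / sb <= F.
  rewrite -(ler_pM2l sb_gt0) (le_trans _ hF) // mulrBr.
  by rewrite [sb * (_ / sb)]mulrC divfK // gt_eqF.
(* The N quadratic terms consume mu y^2 / 2 of the gain 2 mu y^2, leaving the coefficient 3 / 2. *)
have hq : 9 / 4 * mu ^+ 2 * y ^+ 2 *+ N <= 2^-1 * mu * y ^+ 2.
  rewrite -[_ *+ N]mulr_natr.
  have : mu * (9 * N%:R) * (mu * y ^+ 2) <= 2 * (mu * y ^+ 2).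
    by rewrite ler_wpM2r // mulr_ge0 ?sqr_ge0 // ltW.
  lra.
have : 2 * mu * (y ^+ 2 - (N%:R + 3 / 4) * y * a / sb) <= 2 * mu * F.
  by rewrite ler_pM2l // mulr_gt0.
have -> : (2 * N%:R + 3 / 2) * mu * y * a / sb = 2 * mu * ((N%:R + 3 / 4) * y * a / sb).
  by field; rewrite gt_eqF.
lra.
Qed.

End Descent.

(** * The residual dominates the distance *)

Section LowerBound.
Variables (R : realType) (N : nat) (d : 'I_N -> nat) (r : nat -> nat).
Variables (s0 : mindex d) (T : tensor R d) (sb sl : R).
Variables (X Xs : factors R d r).
Hypotheses (sl_gt0 : 0 < sl) (sl_le : sl <= sb).
Hypothesis sbT : forall k, (0 < k < N)%N -> sing_val (unfolding T k) 1 <= sb.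
Hypothesis slT : forall k (h : (k <= N)%N) q (E : 'M[R]_(q, rk N r k)), (0 < k < N)%N ->
  sl ^+ 2 * frob2 E <= frob2 (E *m right_mx s0 Xs h).
Hypotheses (loX : left_orth X) (loXs : left_orth Xs) (ttXs : tt Xs = T).

Let L := @left_mx R N d r s0.
Let Rt := @right_mx R N d r s0.
Let g : tensor R d := fun s => tt X s - T s.
Let y := tnorm g.

Let frob2_unf k : frob2 (unfolding (tt X) k - unfolding T k) = y ^+ 2.
Proof. by rewrite -unfoldingB -sqr_fnorm fnorm_unfolding. Qed.

(* E = (1 - U U^T) V satisfies E M = - (1 - U U^T) G, where M is the right part of Xs
   and G the unfolded residual; M is bounded below by [sl]. *)
Lemma alignment k (h : (k <= N)%N) : y < sl -> (0 < k < N)%N ->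
  exists Q : 'M[R]_(rk N r k), Q^T *m Q = 1%:M /\
    sl ^+ 2 * frob2 (L X h - L Xs h *m Q) <= 2 * y ^+ 2.
Proof.
move=> hy kN; have /andP[_ kltN] := kN.
have UU := left_mx_isom s0 h loX kltN; have VV := left_mx_isom s0 h loXs kltN.
set U := L X h; set V := L Xs h; set E := V - U *m (U^T *m V).
have hE : sl ^+ 2 * frob2 E <= y ^+ 2.
  apply: le_trans (slT h E kN) _.
  set G := unfolding (tt X) k - unfolding T k.
  have EM : E *m Rt Xs h = - (G - U *m (U^T *m G)).
    rewrite /G -ttXs !(unfolding_tt s0 _ h) mulmxBr !mulmxBr !mulmxBl -/U -/V.
    rewrite (mulmxA U^T U) UU mul1mx !mulmxA opprB addrAC opprB.
    by rewrite [_ + (_ - _)]addrC subrK.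
  rewrite EM frob2N -(frob2_unf k) -/G frob2B frob2_isom // fdotC fdot_mull -frob2E.
  by have := frob2_ge0 (U^T *m G); lra.
have s2 : 0 < sl ^+ 2 by rewrite exprn_gt0.
have [|Q [QQ hQ]] := procrustes UU VV.
  rewrite -(ltr_pM2l s2) mulr1; apply: le_lt_trans hE _.
  by rewrite ltr_pXn2r // nnegrE ?tnorm_ge0 // ltW.
exists Q; split=> //.
have : sl ^+ 2 * frob2 (U - V *m Q) <= sl ^+ 2 * (2 * frob2 E) by rewrite ler_pM2l.
lra.
Qed.

Lemma aligning_rotations : y < sl -> exists Q : rotations R N r, is_rotations Q /\
  forall k (h : (k <= N)%N), (0 < k < N)%N ->
    sl ^+ 2 * frob2 (L X h - L (rotate Q Xs) h) <= 2 * y ^+ 2.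
Proof.
move=> hy.
have ex k : exists Q : 'M[R]_(rk N r k), [/\ Q^T *m Q = 1%:M,
    (~~ (0 < k < N)%N -> Q = 1%:M) & forall h : (k <= N)%N, (0 < k < N)%N ->
      sl ^+ 2 * frob2 (L X h - L Xs h *m Q) <= 2 * y ^+ 2].
  have [kN|kN] := boolP (0 < k < N)%N; last by exists 1%:M; rewrite trmx1 mulmx1.
  have /andP[_ kltN] := kN.
  have [Q [QQ hQ]] := alignment (ltnW kltN) hy kN.
  by exists Q; split=> // h _; rewrite (bool_irrelevance h (ltnW kltN)).
pose Q : rotations R N r := fun k => sval (cid (ex k)).
have rotQ : is_rotations Q.
  split=> [k||]; rewrite /Q; case: cid => P /= [] //.
    by move=> _ -> //.
  by move=> _ -> //; rewrite ltnn andbF.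
exists Q; split=> // k h kN; rewrite /L left_mx_rotate //.
by rewrite /Q; case: cid => P /= [_ _]; apply.
Qed.

Variable B : factors R d r.
Hypotheses (loB : left_orth B) (ttB : tt B = T).
Hypothesis closeB : forall k (h : (k <= N)%N), (0 < k < N)%N ->
  sl ^+ 2 * frob2 (L X h - L B h) <= 2 * y ^+ 2.

Let Y i := lunf X i - lunf B i.

(** Y_i extended by the isometric left part of X is the difference of the left parts at level i + 1,
    minus the difference at level i propagated through B_i. *)
Lemma frob2_factor_diff (i : 'I_N) : frob2 (Y i) <=
  2 * frob2 (L X (ltn_ord i) - L B (ltn_ord i)) +
  2 * frob2 (ext s0 (L X (ltnW (ltn_ord i)) - L B (ltnW (ltn_ord i))) (@B i)).
Proof.
rewrite -[leLHS]sqr_fnorm -(fnorm_ext_X s0 B loX) sqr_fnorm extBr extBl -!left_mxS.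
apply: le_trans (frob2B_le _ _); rewrite le_eqVlt; apply/orP; left; apply/eqP.
by congr frob2; rewrite opprB addrA subrK.
Qed.

Lemma frob2_lunf_orth (i : 'I_N) : (i.+1 < N)%N -> frob2 (lunf B i) = (r i.+1)%:R.
Proof.
move=> iN; rewrite frob2E fdotE loB // mxtrace1 /rk.
by rewrite iN.
Qed.

(** The ranks enter here: propagating an error through B_i costs at most |L(B_i)|^2 = r_(i+1). The
    factor numbered 0 has no left part to differ in, so [r 1] never appears. *)
Lemma factor_diff_inner (i : 'I_N) : (i.+1 < N)%N ->
  sl ^+ 2 * frob2 (Y i) <= 4 * y ^+ 2 * (1 + (if i == 0%N :> nat then 0 else (r i.+1)%:R)).
Proof.
move=> iN; have s2 : 0 < sl ^+ 2 by rewrite exprn_gt0.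
have h1 := frob2_factor_diff i; have h2 := closeB (ltn_ord i) iN.
have hext : sl ^+ 2 * frob2 (ext s0 (L X (ltnW (ltn_ord i)) - L B (ltnW (ltn_ord i))) (@B i)) <=
    2 * y ^+ 2 * (if i == 0%N :> nat then 0 else (r i.+1)%:R).
  have h3 := frob2_ext_le s0 (L X (ltnW (ltn_ord i)) - L B (ltnW (ltn_ord i))) (@B i).
  rewrite frob2_lunf_orth // in h3.
  have h4 : sl ^+ 2 * frob2 (L X (ltnW (ltn_ord i)) - L B (ltnW (ltn_ord i))) <=
      2 * y ^+ 2 * (if i == 0%N :> nat then 0 else 1).
    case: eqVneq => i0.
      have -> : L X (ltnW (ltn_ord i)) = L B (ltnW (ltn_ord i)).
        by apply: left_mx_local => j; rewrite i0.
      by rewrite subrr frob2E fdot0r !mulr0.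
    by rewrite mulr1 closeB // lt0n i0 ltnW.
  have h5 : sl ^+ 2 * frob2 (ext s0 (L X (ltnW (ltn_ord i)) - L B (ltnW (ltn_ord i))) (@B i)) <=
     sl ^+ 2 * (frob2 (L X (ltnW (ltn_ord i)) - L B (ltnW (ltn_ord i))) * (r i.+1)%:R).
    by rewrite ler_pM2l.
  apply: le_trans h5 _; rewrite mulrA.
  apply: le_trans (ler_wpM2r (ler0n _ _) h4) _.
  by case: eqP => _; rewrite ?mulr0 ?mul0r ?mulr1.
have : sl ^+ 2 * frob2 (Y i) <= sl ^+ 2 * (2 * frob2 (L X (ltn_ord i) - L B (ltn_ord i)) +
  2 * frob2 (ext s0 (L X (ltnW (ltn_ord i)) - L B (ltnW (ltn_ord i))) (@B i))) by rewrite ler_pM2l.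
move: h2 hext; lra.
Qed.

(** The last factor is not orthonormal, so its Frobenius norm must not be used. Instead B_i is moved
    into the right part, whose operator norm is at most [sb]. The constant is 2 + 2 x 2, with sl <=
    sb in the first term. *)
Lemma factor_diff_last (i : 'I_N) : (0 < i)%N -> (i.+1 < N)%N = false ->
  sl ^+ 2 * frob2 (Y i) <= 6 * sb ^+ 2 * y ^+ 2.
Proof.
move=> i0 iN; have s2 : 0 < sl ^+ 2 by rewrite exprn_gt0.
have sb0 : 0 < sb := lt_le_trans sl_gt0 sl_le.
have sbl : sl ^+ 2 <= sb ^+ 2 by rewrite ler_pXn2r // nnegrE ltW.
have h1 := frob2_factor_diff i.
have last (Z : factors R d r) q (E : 'M[R]_(q, rk N r i.+1)) :
    frob2 (E *m Rt Z (ltn_ord i)) = frob2 E.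
  by rewrite -!sqr_fnorm fnorm_Rm_last.
have RXB : Rt X (ltn_ord i) = Rt B (ltn_ord i).
  apply: right_mx_local => j ij; exfalso; move/negP: iN; apply.
  exact: leq_ltn_trans ij (ltn_ord j).
have h2 : frob2 (L X (ltn_ord i) - L B (ltn_ord i)) = y ^+ 2.
  by rewrite -(last B) mulmxBl -{1}RXB -!unfolding_tt ttB frob2_unf.
have h3 : frob2 (ext s0 (L X (ltnW (ltn_ord i)) - L B (ltnW (ltn_ord i))) (@B i)) =
    frob2 ((L X (ltnW (ltn_ord i)) - L B (ltnW (ltn_ord i))) *m Rt B (ltnW (ltn_ord i))).
  rewrite -(last B) extBl !mulmxBl -left_mxS -!unfolding_tt.
  have LH : L X (ltnW (ltn_ord i)) = L (hybrid X B i) (ltnW (ltn_ord i)).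
    by apply: left_mx_local => j ji; rewrite hybrid_lt.
  have -> : ext s0 (L X (ltnW (ltn_ord i))) (@B i) *m Rt B (ltn_ord i) =
      unfolding (tt (hybrid X B i)) i.+1.
    rewrite (unfolding_tt s0 _ (ltn_ord i)) left_mxS -/L -LH hybrid_ge //; congr (_ *m _).
    by apply: right_mx_local => j ij; rewrite hybrid_ge // ltnW.
  have -> : L X (ltnW (ltn_ord i)) *m Rt B (ltnW (ltn_ord i)) = unfolding (tt (hybrid X B i)) i.
    rewrite (unfolding_tt s0 _ (ltnW (ltn_ord i))) LH; congr (_ *m _).
    by apply: right_mx_local => j ij; rewrite hybrid_ge.
  by rewrite -!unfoldingB -!sqr_fnorm !fnorm_unfolding.
have kN : (0 < i < N)%N by rewrite i0 ltn_ord.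
have h4 : frob2 ((L X (ltnW (ltn_ord i)) - L B (ltnW (ltn_ord i))) *m Rt B (ltnW (ltn_ord i))) <=
    sb ^+ 2 * frob2 (L X (ltnW (ltn_ord i)) - L B (ltnW (ltn_ord i))).
  rewrite /Rt right_mxE_isom // ttB mulmxA -!sqr_fnorm -exprMn ler_pXn2r ?nnegrE ?fnorm_ge0 //.
    by apply: le_trans (unfolding_bound sb0 sbT _ kN) _; rewrite fnorm_isomr // left_mx_isom.
  by rewrite mulr_ge0 ?fnorm_ge0 // ltW.
have h5 := closeB (ltnW (ltn_ord i)) kN.
rewrite h2 h3 in h1.
have : sl ^+ 2 * frob2 (Y i) <= sl ^+ 2 * (2 * y ^+ 2 +
   2 * (sb ^+ 2 * frob2 (L X (ltnW (ltn_ord i)) - L B (ltnW (ltn_ord i))))).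
  by rewrite ler_pM2l //; apply: le_trans h1 _; rewrite lerD2l ler_pM2l.
have : sb ^+ 2 * (sl ^+ 2 * frob2 (L X (ltnW (ltn_ord i)) - L B (ltnW (ltn_ord i)))) <=
  sb ^+ 2 * (2 * y ^+ 2) by rewrite ler_pM2l // exprn_gt0.
have : sl ^+ 2 * y ^+ 2 <= sb ^+ 2 * y ^+ 2 by rewrite ler_wpM2r ?sqr_ge0.
lra.
Qed.

Lemma aligned_dist_le : (2 <= N)%N ->
  sl ^+ 2 * \sum_i weight sb i ^+ 2 * frob2 (Y i) <=
  4 * (N%:R + 1 + \sum_(2 <= i < N) (r i)%:R) * sb ^+ 2 * y ^+ 2.
Proof.
move=> hN; have sb0 : 0 < sb := lt_le_trans sl_gt0 sl_le.
pose b (i : nat) : R :=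
  if (i.+1 < N)%N then 4 * (1 + (if i == 0%N then 0 else (r i.+1)%:R)) else 6.
have hb (i : 'I_N) : sl ^+ 2 * (weight sb i ^+ 2 * frob2 (Y i)) <= sb ^+ 2 * y ^+ 2 * b i.
  rewrite /weight /b; case: ifPn => iN.
    have := factor_diff_inner iN.
    move/(ler_wpM2l (sqr_ge0 sb)); set c := (if _ then _ else _); lra.
  have i0 : (0 < i)%N by rewrite -leqNgt in iN; rewrite -ltnS (leq_trans hN).
  by have := factor_diff_last i0 (negbTE iN); lra.
rewrite mulr_sumr; apply: le_trans (ler_sum _ (fun i _ => hb i)) _.
rewrite -mulr_sumr.
suff : \sum_(i < N) b i <= 4 * (N%:R + 1 + \sum_(2 <= i < N) (r i)%:R).
  move/(ler_wpM2l (mulr_ge0 (sqr_ge0 sb) (sqr_ge0 y))); lra.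
rewrite -(big_mkord xpredT b).
(* With n = N - 2 inner factors the constants sum to 4 + 4 n + 6 = 4 N + 2, plus four times the
   ranks, which is below the claimed 4 (N + 1) plus the same. *)
have [n NE] : exists n, N = n.+2 by exists (N - 2)%N; rewrite -addn2 subnK.
rewrite NE big_nat_recr //= big_nat_recl //= 2!big_add1 /=.
have -> : b 0 = 4 by rewrite /b NE /= addr0 mulr1.
have -> : b n.+1 = 6 by rewrite /b NE ltnn.
have -> : \sum_(0 <= i < n) b i.+1 = \sum_(0 <= i < n) (4 + 4 * (r i.+2)%:R).
  apply: eq_big_nat => i /andP[_ iN]; rewrite /b NE !ltnS iN /=; ring.
rewrite big_split /= -mulr_sumr sumr_const_nat subn0 -mulr_natr.
rewrite -[n.+2]addn2 natrD; lra.
Qed.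

End LowerBound.

(** * Linear convergence *)

Section Minimality.
Variables (R : realType) (N : nat) (d : 'I_N -> nat) (r : nat -> nat).
Variables (T : tensor R d) (Xs : factors R d r).
Hypotheses (hN : (2 <= N)%N) (hmin : minimal_decomp T Xs).

Lemma minimal_tt : tt Xs = T. Proof. by case: hmin. Qed.

(** The last rank is 1, and the full column rank of each left unfolding forces r_i <= d_i r_(i-1),
    so positivity propagates downwards. It provides a base index and makes the r_k-th singular
    values meaningful. *)
Lemma minimal_sizes_gt0 : (forall k, (k <= N)%N -> (0 < rk N r k)%N) /\ (forall i, (0 < d i)%N).
Proof.
have [_ rkL _] := hmin.
have step (i : 'I_N) : (0 < rk N r i.+1)%N -> (0 < d i * rk N r i)%N.
  move=> h; apply: leq_trans h _; rewrite -rkL.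
  by apply: leq_trans (rank_leq_row _) _; rewrite sum_nat_const card_ord.
have pos : forall k, (k <= N)%N -> (0 < rk N r k)%N.
  apply: ord_down_ind => [|i IH]; first by rewrite rk_last.
  by have := step i IH; rewrite muln_gt0 => /andP[].
split=> // i; have := step i (pos _ (ltn_ord i)).
by rewrite muln_gt0 => /andP[].
Qed.

Lemma minimal_mindex : exists s : mindex d, True.
Proof.
have [_ d0] := minimal_sizes_gt0.
by exists [ffun k => Ordinal (d0 k)].
Qed.

Lemma rkE k : (0 < k < N)%N -> rk N r k = r k.
Proof. by rewrite /rk => ->. Qed.

Lemma minimal_rank_gt0 k : (0 < k < N)%N -> (0 < r k)%N.
Proof.
move=> kN; rewrite -rkE //; apply: minimal_sizes_gt0.1.
by case/andP: kN => _ /ltnW.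
Qed.

Lemma sing_val_min_gt0 s0 k (h : (k <= N)%N) : left_orth Xs -> (0 < k < N)%N ->
  0 < sing_val (unfolding T k) (r k) /\
  forall q (E : 'M[R]_(q, rk N r k)),
    sing_val (unfolding T k) (r k) ^+ 2 * frob2 E <= frob2 (E *m right_mx s0 Xs h).
Proof.
move=> lo kN; have [TE _ rkR] := hmin; have /andP[_ kltN] := kN.
rewrite -(rkE kN).
apply: (sing_val_rank _ (left_mx_isom s0 h lo kltN) _ (right_mx_row_free s0 h rkR)).
  by rewrite rkE ?minimal_rank_gt0.
by rewrite TE (unfolding_tt s0 _ h).
Qed.

Lemma sigma_min_le k : (0 < k < N)%N -> sigma_min r T <= sing_val (unfolding T k) (r k).
Proof.
case/andP=> k0 kN; rewrite /sigma_min.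
apply: le_trans (@le_bigmin_nat _ _ _ 1 N k k.+1 xpredT _ k0 kN) _.
by rewrite big_ltn // big_geq // ge_min lexx.
Qed.

Lemma le_sigma_max k : (0 < k < N)%N -> sing_val (unfolding T k) 1 <= sigma_max T.
Proof.
move=> kN; apply: (@le_bigmax_seq _ _ _ _ _ k xpredT (fun i => sing_val (unfolding T i) 1)) => //.
by rewrite mem_index_iota.
Qed.

Lemma sigma_min_gt0 : left_orth Xs -> 0 < sigma_min r T.
Proof.
move=> lo; have [s0 _] := minimal_mindex.
have pos k : (0 < k < N)%N -> 0 < sing_val (unfolding T k) (r k).
  move=> kN; have /andP[_ kltN] := kN.
  by have [] := sing_val_min_gt0 s0 (ltnW kltN) lo kN.
rewrite /sigma_min big_seq; elim/big_ind: _ => [|x z x0 z0|k].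
- exact: pos.
- by rewrite lt_min x0.
- by rewrite mem_index_iota; apply: pos.
Qed.

Lemma sigma_min_le_max : sigma_min r T <= sigma_max T.
Proof.
have N1 : (0 < 1 < N)%N by [].
apply: le_trans (sigma_min_le N1) _; apply: le_trans (le_sigma_max N1).
exact: sing_val_le1.
Qed.

End Minimality.

(** * The distance as an infimum over rotations *)

Section Dist.
Variables (R : realType) (N : nat) (d : 'I_N -> nat) (r : nat -> nat).
Variables (sb : R) (X Xs : factors R d r).

Lemma aligned_dist2E Q : aligned_dist2 sb X Xs Q =
  \sum_i weight sb i ^+ 2 * frob2 (lunf X i - lunf (rotate Q Xs) i).
Proof.
rewrite /aligned_dist2 [RHS](bigID (fun i : 'I_N => (i.+1 < N)%N)) /=; congr (_ + _).
  by apply: eq_bigr => i iN; rewrite /weight iN.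
apply: eq_big => [i|i /eqP iN].
  by rewrite -leqNgt eqn_leq ltn_ord.
by rewrite /weight (_ : (i.+1 < N)%N = false) ?expr1n ?mul1r // iN ltnn.
Qed.

Lemma aligned_dist2_ge0 Q : 0 <= aligned_dist2 sb X Xs Q.
Proof.
by rewrite aligned_dist2E sumr_ge0 // => i _; rewrite mulr_ge0 ?sqr_ge0 ?frob2_ge0.
Qed.

Lemma dist2_set_lbound :
  lbound [set aligned_dist2 sb X Xs Q | Q in is_rotations (N := N) (r := r)] 0.
Proof. by move=> _ [Q _ <-]; apply: aligned_dist2_ge0. Qed.

Lemma dist2_set_neq0 :
  [set aligned_dist2 sb X Xs Q | Q in is_rotations (N := N) (r := r)] !=set0.
Proof.
exists (aligned_dist2 sb X Xs (fun k => 1%:M)); exists (fun k => 1%:M) => //.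
by split=> // k; rewrite trmx1 mulmx1.
Qed.

Lemma dist2_ge0 : 0 <= dist2 sb X Xs.
Proof. exact: lb_le_inf dist2_set_neq0 dist2_set_lbound. Qed.

Lemma dist2_le Q : is_rotations Q -> dist2 sb X Xs <= aligned_dist2 sb X Xs Q.
Proof.
move=> rotQ; apply: ge_inf; last by exists Q.
by exists 0; apply: dist2_set_lbound.
Qed.

Lemma dist2_approx e : 0 < e -> exists Q,
  is_rotations Q /\ aligned_dist2 sb X Xs Q < dist2 sb X Xs + e.
Proof.
move=> e0; have [|_ [Q rotQ <-] h] := @inf_adherent R
  [set aligned_dist2 sb X Xs Q | Q in is_rotations (N := N) (r := r)] e e0.
  split; [exact: dist2_set_neq0 | by exists 0; apply: dist2_set_lbound].
by exists Q.
Qed.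

End Dist.

(** * One iteration inside the basin of attraction *)

Section Contraction.
Variables (R : realType) (N : nat) (d : 'I_N -> nat) (r : nat -> nat).
Variables (T : tensor R d) (Xs : factors R d r) (mu : R).
Hypotheses (hN : (2 <= N)%N) (hmin : minimal_decomp T Xs) (loXs : left_orth Xs).
Hypotheses (mu_gt0 : 0 < mu) (hmu : mu <= 1 / (9 * N%:R - 5)).

Let sb := sigma_max T.
Let sl := sigma_min r T.
Let S : R := N%:R + 1 + \sum_(2 <= i < N) (r i)%:R.
Let radius : R := sl ^+ 2 / (72 * (N%:R ^+ 2 - 1) * S).

Let sl_gt0 : 0 < sl. Proof. exact: sigma_min_gt0 hmin loXs. Qed.
Let sl_le : sl <= sb. Proof. by apply: sigma_min_le_max. Qed.
Let sb_gt0 : 0 < sb. Proof. exact: lt_le_trans sl_le. Qed.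
Let N2 : @Order.le _ R 2 N%:R. Proof. by rewrite (ler_nat R 2). Qed.
Let S_ge : 3 <= S.
Proof.
have := N2; rewrite /S; have : 0 <= \sum_(2 <= i < N) ((r i)%:R : R) by apply: sumr_ge0.
lra.
Qed.
Let den_gt0 : 0 < 72 * (N%:R ^+ 2 - 1) * S.
Proof. have n1 : @Order.lt _ R 0 (N%:R ^+ 2 - 1) by have := N2; nra.
by rewrite !mulr_gt0 // (lt_le_trans _ S_ge). Qed.
Let radius_gt0 : 0 < radius.
Proof. by rewrite divr_gt0 ?exprn_gt0. Qed.
Let radiusE : radius * (72 * (N%:R ^+ 2 - 1) * S) = sl ^+ 2.
Proof. by rewrite divfK // gt_eqF. Qed.

Variables X X' : factors R d r.
Hypothesis loX : left_orth X.
Hypothesis near : dist2 sb X Xs <= radius.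
Hypothesis stepX : forall i : 'I_N, lunf X' i =
  if (i.+1 < N)%N then
    polar_retr (lunf X i - (mu / sb ^+ 2) *: stiefel_proj (lunf X i) (grad_lunf (tt_loss T) X i))
  else lunf X i - mu *: grad_lunf (tt_loss T) X i.

Let y := tnorm (fun s => tt X s - T s).
Let D := dist2 sb X Xs.

Let ttRot Q : is_rotations Q -> tt (rotate Q Xs) = T.
Proof. by move=> rotQ; rewrite tt_rotate // (minimal_tt hmin). Qed.

Let loRot Q : is_rotations Q -> left_orth (rotate Q Xs).
Proof. by move=> rotQ; apply: left_orth_rotate. Qed.

Let sum_sqr Q : \sum_i (weight sb i * fnorm (lunf X i - lunf (rotate Q Xs) i)) ^+ 2 =
  aligned_dist2 sb X Xs Q.
Proof. by rewrite aligned_dist2E; apply: eq_bigr => i _; rewrite exprMn sqr_fnorm. Qed.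

Lemma left_orth_next : left_orth X'.
Proof. exact: left_orth_step loX loXs _ _ stepX. Qed.

Lemma residual_le : y <= sl / 2.
Proof.
(* A slack equal to the radius bounds the aligned distance by twice the radius; then y^2 <= 2 N
   [radius] <= sl^2 / 4. *)
have [Q [rotQ hQ]] := dist2_approx sb X Xs radius_gt0.
have [s0 _] := minimal_mindex hmin.
have := sqr_tnorm_g_le s0 sb_gt0 (le_sigma_max T) loX (loRot rotQ) (ttRot rotQ).
rewrite sum_sqr -/y => h.
rewrite -(@ler_pXn2r _ 2) ?nnegrE ?tnorm_ge0 ?divr_ge0 ?(ltW sl_gt0) //.
apply: le_trans h _.
have hA : aligned_dist2 sb X Xs Q <= 2 * radius by move: near hQ; rewrite -/D; lra.
apply: (@le_trans _ _ (N%:R * (2 * radius))); first by rewrite ler_wpM2l ?ler0n.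
rewrite expr_div_n -radiusE.
have h1 : 8 * N%:R <= 72 * (N%:R ^+ 2 - 1) * S.
  have a1 : N%:R <= (N%:R ^+ 2 - 1 : R) by have := N2; nra.
  have := S_ge; have := N2; move: a1; nra.
have := ler_wpM2l (ltW radius_gt0) h1; lra.
Qed.

Lemma dist2_lower : sl ^+ 2 * D <= 4 * S * sb ^+ 2 * y ^+ 2.
Proof.
have [s0 _] := minimal_mindex hmin.
have y_lt : y < sl by have := residual_le; have := sl_gt0; lra.
have slT k (h : (k <= N)%N) q (E : 'M[R]_(q, rk N r k)) : (0 < k < N)%N ->
    sl ^+ 2 * frob2 E <= frob2 (E *m right_mx s0 Xs h).
  move=> kN; have [p hE] := sing_val_min_gt0 hmin s0 h loXs kN.
  apply: le_trans (hE _ E); rewrite ler_wpM2r ?frob2_ge0 //.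
  by rewrite ler_pXn2r ?nnegrE ?sigma_min_le // ltW.
have [Q [rotQ hQ]] := aligning_rotations sl_gt0 slT loX loXs (minimal_tt hmin) y_lt.
have := aligned_dist_le sl_gt0 sl_le (le_sigma_max T) loX (loRot rotQ) (ttRot rotQ) hQ hN.
rewrite -aligned_dist2E; apply: le_trans.
by rewrite ler_pM2l ?exprn_gt0 // dist2_le.
Qed.

(* Attainment of the infimum is not needed: the one-step bound for a rotation is affine
   in its aligned distance, so it passes to the infimum. *)
Lemma dist2_descent :
  dist2 sb X' Xs <= D - 3 / 2 * mu * y ^+ 2 + (2 * N%:R + 3 / 2) * mu * y * D / sb.
Proof.
have y0 : 0 <= y := tnorm_ge0 _.
pose K := 1 + (2 * N%:R + 3 / 2) * mu * y / sb.
have c0 : 0 <= 2 * N%:R + 3 / 2 :> R by have := N2; lra.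
have K0 : 0 < K.
  by rewrite ltr_pwDl // divr_ge0 ?(ltW sb_gt0) // mulr_ge0 // mulr_ge0 // ltW.
have KE x : K * x - 3 / 2 * mu * y ^+ 2 =
    x - 3 / 2 * mu * y ^+ 2 + (2 * N%:R + 3 / 2) * mu * y * x / sb.
  by rewrite /K; field; rewrite gt_eqF.
rewrite -KE; apply/ler_addgt0Pr => e e0.
have [Q [rotQ hQ]] := dist2_approx sb X Xs (divr_gt0 e0 K0).
have [s0 _] := minimal_mindex hmin.
have hy : y <= sb / 2 by have := residual_le; have := sl_le; lra.
(* For N >= 2, 9 N <= 2 (9 N - 5). *)
have hmu9 : mu * (9 * N%:R) <= 2.
  have p : 0 < 9 * N%:R - 5 :> R by have := N2; lra.
  move: hmu; rewrite ler_pdivlMr // => h.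
  have : mu * (9 * N%:R) <= mu * (2 * (9 * N%:R - 5)).
    by rewrite ler_pM2l //; have := N2; lra.
  lra.
have := descent s0 sb_gt0 (le_sigma_max T) loX (loRot rotQ) (ttRot rotQ) mu_gt0 stepX hy hmu9.
rewrite sum_sqr -aligned_dist2E -/y -KE => h.
apply: le_trans (dist2_le _ _ _ rotQ) _; apply: le_trans h _.
rewrite addrAC lerB // -[e in leRHS](divfK (lt0r_neq0 K0)) [e / K * K]mulrC -mulrDr.
by rewrite ler_pM2l // ltW.
Qed.

Lemma dist2_contract :
  dist2 sb X' Xs <= (1 - 1 / (64 * S * cond_number r T ^+ 2) * mu) * D.
Proof.
have y0 : 0 <= y := tnorm_ge0 _.
have D0 : 0 <= D := dist2_ge0 _ _ _.
have N2' := N2; have s2 : 0 < sl ^+ 2 by rewrite exprn_gt0.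
have Sp : 0 < S by have := S_ge; lra.
(* The radius is calibrated for this. In the square, one D is bounded by the radius and the other by
   [dist2_lower], and 72 = 18 x 4 with (2 N + 3/2)^2 <= 18 (N^2 - 1). *)
have cross : (2 * N%:R + 3 / 2) * D <= sb * y.
  have c0 : 0 <= 2 * N%:R + 3 / 2 :> R by lra.
  rewrite -(@ler_pXn2r _ 2) ?nnegrE ?mulr_ge0 ?(ltW sb_gt0) //.
  have hc : (2 * N%:R + 3 / 2) ^+ 2 <= 18 * (N%:R ^+ 2 - 1) :> R by nra.
  rewrite exprMn; apply: le_trans (ler_wpM2r (sqr_ge0 D) hc) _.
  rewrite -(ler_pM2l s2).
  have h1 : sl ^+ 2 * D * D <= 4 * S * sb ^+ 2 * y ^+ 2 * radius.
    by apply: ler_pM => //; [rewrite mulr_ge0 // ltW | exact: dist2_lower].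
  have c1 : 0 <= 18 * (N%:R ^+ 2 - 1) :> R by nra.
  have := ler_wpM2l c1 h1.
  have -> : sl ^+ 2 * (sb * y) ^+ 2 = 18 * (N%:R ^+ 2 - 1) * (4 * S * sb ^+ 2 * y ^+ 2 * radius).
    by rewrite -radiusE; ring.
  by apply: le_trans; rewrite le_eqVlt; apply/orP; left; apply/eqP; ring.
have h := dist2_descent.
have h2 : (2 * N%:R + 3 / 2) * mu * y * D / sb <= mu * y ^+ 2.
  rewrite ler_pdivrMr //; have := ler_wpM2l (mulr_ge0 (ltW mu_gt0) y0) cross; lra.
have cp : 0 < cond_number r T by rewrite divr_gt0.
have den : 0 < 4 * S * cond_number r T ^+ 2 by rewrite mulr_gt0 ?exprn_gt0 // mulr_gt0.
have lower : D / (4 * S * cond_number r T ^+ 2) <= y ^+ 2.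
  rewrite ler_pdivrMr //.
  rewrite /cond_number -/sb -/sl expr_div_n -(ler_pM2l s2).
  apply: le_trans dist2_lower _.
  by rewrite le_eqVlt; apply/orP; left; apply/eqP; field; rewrite gt_eqF.
(* Here 64 = 16 x 4. Once the error term is absorbed, a decrease of mu y^2 / 2 remains, which
   dominates the mu / 16 share taken here. *)
have -> : (1 - 1 / (64 * S * cond_number r T ^+ 2) * mu) * D =
   D - mu / 16 * (D / (4 * S * cond_number r T ^+ 2)).
  by field; rewrite !gt_eqF.
have q0 : 0 <= D / (4 * S * cond_number r T ^+ 2).
  by rewrite divr_ge0 // ltW.
have := ler_wpM2l (ltW mu_gt0) lower; have := mulr_ge0 (ltW mu_gt0) q0.
move: h h2; lra.
Qed.

Lemma dist2_next_le : dist2 sb X' Xs <= radius.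
Proof.
apply: le_trans near; apply: le_trans dist2_contract _.
apply: ler_piMl (dist2_ge0 _ _ _) _; rewrite gerBl mulr_ge0 ?(ltW mu_gt0) //.
by rewrite divr_ge0 // mulr_ge0 ?sqr_ge0 // mulr_ge0 // (le_trans _ S_ge).
Qed.

End Contraction.

Theorem theorem2 (R : realType) (N : nat) (hN : (2 <= N)%N)
  (d : 'I_N -> nat) (r : nat -> nat)
  (Xstar : tensor R d) (Xs : factors R d r)
  (hranks : has_tt_ranks r Xstar)
  (hmin : minimal_decomp Xstar Xs)
  (hlo : left_orth Xs)
  (mu : R) (hmu : 0 < mu)
  (X : nat -> factors R d r)
  (hX0 : left_orth (X 0%N))
  (hrgd : rgd_iterates (tt_loss Xstar) (sigma_max Xstar) mu X)
  (hinit : dist2 (sigma_max Xstar) (X 0%N) Xs <=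
     sigma_min r Xstar ^+ 2 /
       (72 * (N%:R ^+ 2 - 1) * (N%:R + 1 + \sum_(2 <= i < N) (r i)%:R)))
  (hstep : mu <= 1 / (9 * N%:R - 5)) :
  forall t : nat,
    dist2 (sigma_max Xstar) (X t.+1) Xs <=
      (1 - 1 / (64 * (N%:R + 1 + \sum_(2 <= i < N) (r i)%:R)
                * cond_number r Xstar ^+ 2) * mu)
      * dist2 (sigma_max Xstar) (X t) Xs.
Proof.
have inv t : left_orth (X t) /\ dist2 (sigma_max Xstar) (X t) Xs <=
    sigma_min r Xstar ^+ 2 /
      (72 * (N%:R ^+ 2 - 1) * (N%:R + 1 + \sum_(2 <= i < N) (r i)%:R)).
  elim: t => [//|t [lo near]]; split.
    exact (left_orth_next hlo lo (hrgd t)).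
  exact (dist2_next_le hN hmin hlo hmu hstep lo near (hrgd t)).
move=> t; have [lo near] := inv t.
exact (dist2_contract hN hmin hlo hmu hstep lo near (hrgd t)).
Qed.
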